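(* Let $k$ be $\mathbb{R}$ or $\mathbb{C}$, and let $(\mathcal{L},\mathcal{B},(\cdot,\cdot))$ be a finite-dimensional Maurer–Cartan–Poisson (MCP) structure over $k$. Let $\Pi$ be the smooth bivector field on $L^1$ given by $$\Pi_X(a,b)=(X,\ \delta_Xa\wedge\delta_Xb),\qquad X\in L^1,\ a,b\in B^2\cong T_X^*L^1 .$$ Then $\Pi$ defines a Poisson structure on each gauge orbit $\mathcal{O}\subset\mathrm{MC}(\mathcal{L})$.
   Context: For a dgla $\mathcal{L}=(L,d,[\cdot,\cdot])$, $\mathrm{MC}(\mathcal{L})=\{X\in L^1: dX+\frac12[X,X]=0\}$, and $d_X=d+[X,\cdot]$ for $X\in L^1$. The Lie algebra $L^0$ acts on $L^1$ by the vector fields $X\mapsto d\lambda+[X,\lambda]$; their flows preserve $\mathrm{MC}(\mathcal{L})$ and decompose it into gauge orbits, each a smooth immersed submanifold of $L^1$. A BV algebra $(B,\delta,\wedge)$ is a graded vector space with an associative graded commutative product $\wedge:B^i\times B^j\to B^{i+j}$ and a differential $\delta:B^i\to B^{i-1}$, $\delta^2=0$, such that $[a,b]_{\mathcal{B}}=(-1)^{|a|}(\delta(a\wedge b)-\delta a\wedge b-(-1)^{|a|}a\wedge\delta b)$ is a graded Lie bracket (with degrees shifted by one), and $\delta$ is of order two: $\delta(a\wedge b\wedge c)-\delta(a\wedge b)\wedge c+\delta a\wedge b\wedge c-(-1)^{|a|}a\wedge\delta(b\wedge c)-(-1)^{(|a|+1)|b|}b\wedge\delta(a\wedge c)+(-1)^{|a|}a\wedge\delta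 b\wedge c+(-1)^{|a|+|b|}a\wedge b\wedge\delta c=0.$ An MCP structure with base dgla $\mathcal{L}$ is a triple $(\mathcal{L},\mathcal{B},(\cdot,\cdot))$ of a dgla $\mathcal{L}$, a graded commutative algebra $\mathcal{B}=(B,\wedge)$ and non-degenerate bilinear pairings $(\cdot,\cdot):L^i\times B^{i+1}\to k$ such that for each $X\in\mathrm{MC}(\mathcal{L})$: (1) $d_XX=0$; (2) the map $\delta_X:B^i\to B^{i-1}$ defined by $(d_X\,\cdot,\cdot)=(\cdot,\delta_X\,\cdot)$ makes $\mathcal{B}_X=(B,\delta_X,\wedge)$ a BV algebra; (3) there is $k_X\in k$ such that the linear map $\rho_X:B^1\to L^0$ defined by $(X,a\wedge b)=(\rho_Xa,b)$ satisfies $[\rho_Xa,\rho_Xb]=k_X\rho_X[a,b]_{\mathcal{B}_X}$ for all $a,b\in B^1$. Finite-dimensional means $L$ is finite-dimensional; then the pairing identifies $T_X^*L^1=(L^1)^\vee$ with $B^2$. The operator $\delta_X$ is defined as the adjoint of $d_X$ for all $X\in L^1$. *)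

(* Defs.v *)
From HB Require Import structures.
From mathcomp Require Import all_boot all_order all_algebra.
From mathcomp Require Import all_classical all_reals all_analysis.
From mathcomp Require Export complex.
From Stdlib Require Export Relation_Operators.

Set Implicit Arguments.
Unset Strict Implicit.
Unset Printing Implicit Defensive.

Import Order.TTheory GRing.Theory Num.Theory.
Import numFieldNormedType.Exports.
Import VectorInternalTheory.

Local Open Scope classical_set_scope.
Local Open Scope ring_scope.

(* Graded spaces are internally Z-graded: [gr i] is the set of homogeneous    *)
(* elements of degree [i] and V is the direct sum of the [gr i]. Identities   *)
(* involving degrees are only ever imposed on homogeneous elements.           *)
Record grading (k : fieldType) (V : lmodType k) := Grading {
  gr :> int -> set V;
  gr0 : forall i, gr i 0;
  gr_linear : forall i (c : k) u v, gr i u -> gr i v -> gr i (c *: u + v);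
  gr_generate : forall v, exists (s : seq int) (c : int -> V),
    (forall i, gr i (c i)) /\ v = \sum_(i <- s) c i;
  gr_direct : forall (s : seq int) (c : int -> V), uniq s ->
    (forall i, gr i (c i)) -> \sum_(i <- s) c i = 0 ->
    forall i, i \in s -> c i = 0
}.

Record dgla (k : fieldType) (L : lmodType k) := Dgla {
  dgla_gr :> grading L;
  dgla_d : {linear L -> L};
  dgla_br : {bilinear L -> L -> L};
  dgla_d_deg : forall i x, dgla_gr i x -> dgla_gr (i + 1) (dgla_d x);
  dgla_br_deg : forall i j x y, dgla_gr i x -> dgla_gr j y ->
    dgla_gr (i + j) (dgla_br x y);
  dgla_d_sq : forall x, dgla_d (dgla_d x) = 0;
  dgla_anti : forall i j x y, dgla_gr i x -> dgla_gr j y ->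
    dgla_br x y = - ((-1) ^ (i * j) *: dgla_br y x);
  dgla_jacobi : forall i j l x y z,
    dgla_gr i x -> dgla_gr j y -> dgla_gr l z ->
    dgla_br x (dgla_br y z) =
      dgla_br (dgla_br x y) z + (-1) ^ (i * j) *: dgla_br y (dgla_br x z);
  dgla_leibniz : forall i x y, dgla_gr i x ->
    dgla_d (dgla_br x y) =
      dgla_br (dgla_d x) y + (-1) ^ i *: dgla_br x (dgla_d y)
}.

Definition MC (k : fieldType) (L : lmodType k) (D : dgla L) : set L :=
  [set X | D 1 X /\ dgla_d D X + 2%:R^-1 *: dgla_br D X X = 0].

(* d_X = d + [X, -] *)
Definition twist (k : fieldType) (L : lmodType k) (D : dgla L) (X x : L) : L :=
  dgla_d D x + dgla_br D X x.

(* No unit is required. *)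
Record gcalgebra (k : fieldType) (B : lmodType k) := GCAlgebra {
  gca_gr :> grading B;
  wedge : {bilinear B -> B -> B};
  wedge_deg : forall i j a b, gca_gr i a -> gca_gr j b ->
    gca_gr (i + j) (wedge a b);
  wedge_assoc : forall a b c, wedge a (wedge b c) = wedge (wedge a b) c;
  wedge_comm : forall i j a b, gca_gr i a -> gca_gr j b ->
    wedge a b = (-1) ^ (i * j) *: wedge b a
}.

(* The bracket generated by [delta], where [i] is the degree of [a]. *)
Definition bv_bracket (k : fieldType) (B : lmodType k) (A : gcalgebra B)
    (delta : B -> B) (i : int) (a b : B) : B :=
  (-1) ^ i *: (delta (wedge A a b) - wedge A (delta a) b
               - (-1) ^ i *: wedge A a (delta b)).

Record is_BV (k : fieldType) (B : lmodType k) (A : gcalgebra B)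
    (delta : B -> B) : Prop := IsBV {
  bv_linear : linear delta;
  bv_deg : forall i a, A i a -> A (i - 1) (delta a);
  bv_sq : forall a, delta (delta a) = 0;
  bv_anti : forall i j a b, A i a -> A j b ->
    bv_bracket A delta i a b =
      - ((-1) ^ ((i - 1) * (j - 1)) *: bv_bracket A delta j b a);
  (* [a, b] has degree |a| + |b| - 1 *)
  bv_jacobi : forall i j l a b c, A i a -> A j b -> A l c ->
    bv_bracket A delta i a (bv_bracket A delta j b c) =
      bv_bracket A delta (i + j - 1) (bv_bracket A delta i a b) c
      + (-1) ^ ((i - 1) * (j - 1)) *:
          bv_bracket A delta j b (bv_bracket A delta i a c);
  bv_order2 : forall i j l a b c, A i a -> A j b -> A l c ->
    delta (wedge A (wedge A a b) c)
    - wedge A (delta (wedge A a b)) c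
    + wedge A (wedge A (delta a) b) c
    - (-1) ^ i *: wedge A a (delta (wedge A b c))
    - (-1) ^ ((i + 1) * j) *: wedge A b (delta (wedge A a c))
    + (-1) ^ i *: wedge A (wedge A a (delta b)) c
    + (-1) ^ (i + j) *: wedge A (wedge A a b) (delta c) = 0
}.

(* The adjoint of d_X, and the map rho_X, with respect to a pairing; both are *)
(* determined by their defining equations when the pairing is non-degenerate. *)
Definition adjoint_of (k : fieldType) (L B : lmodType k) (D : dgla L)
    (pair : {bilinear L -> B -> k^o}) (X : L) (a : B) : B :=
  xget 0 [set b | forall x, pair (twist D X x) a = pair x b].

Definition rho_of (k : fieldType) (L B : lmodType k) (D : dgla L)
    (A : gcalgebra B) (pair : {bilinear L -> B -> k^o}) (X : L) (a : B) : L :=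
  xget 0 [set r | D 0 r /\
    forall b, A 1 b -> pair X (wedge A a b) = pair r b].

(* The pairings L^i x B^(i+1) -> k are assembled into one bilinear map on     *)
(* L x B, extended by zero to the other pairs of degrees.                     *)
Record mcp (k : fieldType) (L B : lmodType k) := Mcp {
  mcp_dgla :> dgla L;
  mcp_alg : gcalgebra B;
  mcp_pair : {bilinear L -> B -> k^o};
  mcp_pair_deg : forall i j x a, mcp_dgla i x -> mcp_alg j a -> j != i + 1 ->
    mcp_pair x a = 0;
  mcp_nondegl : forall i x, mcp_dgla i x ->
    (forall a, mcp_alg (i + 1) a -> mcp_pair x a = 0) -> x = 0;
  mcp_nondegr : forall i a, mcp_alg (i + 1) a ->
    (forall x, mcp_dgla i x -> mcp_pair x a = 0) -> a = 0;
  mcp_flat : forall X, MC mcp_dgla X -> twist mcp_dgla X X = 0;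
  mcp_adjoint : forall X, MC mcp_dgla X -> forall x a,
    mcp_pair (twist mcp_dgla X x) a =
      mcp_pair x (adjoint_of mcp_dgla mcp_pair X a);
  mcp_BV : forall X, MC mcp_dgla X ->
    is_BV mcp_alg (adjoint_of mcp_dgla mcp_pair X);
  mcp_rho_spec : forall X, MC mcp_dgla X -> forall a, mcp_alg 1 a ->
    mcp_dgla 0 (rho_of mcp_dgla mcp_alg mcp_pair X a) /\
    forall b, mcp_alg 1 b -> mcp_pair X (wedge mcp_alg a b) =
      mcp_pair (rho_of mcp_dgla mcp_alg mcp_pair X a) b;
  mcp_rho_br : forall X, MC mcp_dgla X -> exists kX : k,
    forall a b, mcp_alg 1 a -> mcp_alg 1 b ->
      dgla_br mcp_dgla (rho_of mcp_dgla mcp_alg mcp_pair X a)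
                       (rho_of mcp_dgla mcp_alg mcp_pair X b) =
      kX *: rho_of mcp_dgla mcp_alg mcp_pair X
              (bv_bracket mcp_alg (adjoint_of mcp_dgla mcp_pair X) 1 a b)
}.

Definition mcp_delta (k : fieldType) (L B : lmodType k) (M : mcp L B)
    (X : L) (a : B) : B := adjoint_of M (mcp_pair M) X a.

Definition mcp_Pi (k : fieldType) (L B : lmodType k) (M : mcp L B)
    (X : L) (a b : B) : k :=
  mcp_pair M X (wedge (mcp_alg M) (mcp_delta M X a) (mcp_delta M X b)).

(* C^n and C^oo functions on an open set, in the sense of the base field: for *)
(* k = R these are the usual notions, for k = C the derivatives are complex.  *)
Fixpoint Cn (k : numFieldType) (V W : normedModType k) (n : nat)
    (U : set V) (f : V -> W) : Prop :=
  if n is n'.+1 then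
    (forall x, U x -> differentiable f x) /\ (forall v, Cn n' U ('D_v f))
  else forall x, U x -> {for x, continuous f}.

Definition smooth (k : numFieldType) (V W : normedModType k)
    (U : set V) (f : V -> W) : Prop := forall n, Cn n U f.

(* Differential of a map into a finite-dimensional space, computed in the     *)
(* coordinates [v2r].                                                         *)
Definition dmap (k : numFieldType) (V : normedModType k) (L : vectType k)
    (f : V -> L) (u h : V) : L := r2v ('D_h (v2r \o f) u).

(* Integral curves of the vector field X |-> d lam + [X, lam] on L^1. For     *)
(* k = C time is complex; as [lam] may be multiplied by complex scalars, the  *)
(* orbits are the same as for real time.                                      *)
Definition gauge_curve (k : numFieldType) (L : vectType k) (D : dgla L)
    (lam : L) (gamma : k^o -> L) : Prop :=
  forall t, D 1 (gamma t) /\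
    is_derive t 1 (v2r \o gamma) (v2r (twist D (gamma t) lam)).

Definition gauge_step (k : numFieldType) (L : vectType k) (D : dgla L)
    (X Y : L) : Prop :=
  exists (lam : L) (gamma : k^o -> L) (t : k),
    [/\ D 0 lam, gauge_curve D lam gamma, gamma 0 = X & gamma t = Y].

Definition gauge_orbit (k : numFieldType) (L : vectType k) (D : dgla L)
    (X : L) : set L := [set Y | clos_refl_trans L (gauge_step D) X Y].

Definition gauge_tangent (k : numFieldType) (L : vectType k) (D : dgla L)
    (X : L) : set L := [set v | exists2 lam, D 0 lam & v = twist D X lam].

(* Inverses of charts of the immersed submanifold O. A map [phi] satisfying   *)
(* these conditions sends integral curves of the vector fields                *)
(* (d phi)^-1 (d lam + [phi, lam]) to gauge flow lines, so it is a            *)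
(* diffeomorphism onto an open subset for the leaf topology of O.             *)
Record orbit_chart (k : numFieldType) (L : vectType k) (D : dgla L)
    (O : set L) (m : nat) (U : set 'rV[k]_m) (phi : 'rV[k]_m -> L) : Prop :=
  OrbitChart {
  chart_open : open U;
  chart_smooth : smooth U (v2r \o phi);
  chart_sub : forall u, U u -> O (phi u);
  chart_inj : forall u v, U u -> U v -> phi u = phi v -> u = v;
  chart_immersion : forall u h, U u -> dmap phi u h = 0 -> h = 0;
  chart_tangent : forall u, U u ->
    range (dmap phi u) = gauge_tangent D (phi u)
}.

(* The bracket {f, g} = sum_ij pi_ij (d_i f) (d_j g). *)
Definition bivector_bracket (k : numFieldType) (m : nat)
    (pi : 'rV[k]_m -> 'M[k]_m) (f g : 'rV[k]_m -> k^o) (u : 'rV[k]_m) : k^o :=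
  \sum_(i < m) \sum_(j < m) pi u i j * 'D_('e_i) f u * 'D_('e_j) g u.

Record poisson_bivector (k : numFieldType) (m : nat) (U : set 'rV[k]_m)
    (pi : 'rV[k]_m -> 'M[k]_m) : Prop := PoissonBivector {
  pb_smooth : smooth U pi;
  pb_anti : forall u i j, U u -> pi u j i = - pi u i j;
  pb_jacobi : forall f g h : 'rV[k]_m -> k^o,
    smooth U f -> smooth U g -> smooth U h -> forall u, U u ->
    bivector_bracket pi f (bivector_bracket pi g h) u
    + bivector_bracket pi g (bivector_bracket pi h f) u
    + bivector_bracket pi h (bivector_bracket pi f g) u = 0
}.

(* Pi restricts to a Poisson structure on O: at each X in O the bivector Pi_X *)
(* lies in the second exterior power of the tangent space of O, and in every  *)
(* chart Pi is the image of a smooth bivector whose bracket satisfies the     *)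
(* Jacobi identity. Covectors on L^1 are elements of B^2, via the pairing.    *)
Record poisson_on_orbit (k : numFieldType) (L : vectType k) (B : lmodType k)
    (M : mcp L B) (O : set L) : Prop := PoissonOnOrbit {
  poo_anti : forall X a b, O X -> mcp_alg M 2 a -> mcp_alg M 2 b ->
    mcp_Pi M X b a = - mcp_Pi M X a b;
  poo_tangent : forall X a b, O X -> mcp_alg M 2 a -> mcp_alg M 2 b ->
    (forall v, gauge_tangent M X v -> mcp_pair M v a = 0) ->
    mcp_Pi M X a b = 0;
  poo_chart : forall (m : nat) (U : set 'rV[k]_m) (phi : 'rV[k]_m -> L),
    orbit_chart M O U phi ->
    exists pi : 'rV[k]_m -> 'M[k]_m,
      poisson_bivector U pi /\
      forall u a b, U u -> mcp_alg M 2 a -> mcp_alg M 2 b ->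
        mcp_Pi M (phi u) a b =
        \sum_(i < m) \sum_(j < m) pi u i j
          * mcp_pair M (dmap phi u 'e_i) a * mcp_pair M (dmap phi u 'e_j) b
}.

(* Main.v *)
(* For X in MC and covectors a, b in B^2, the Hamiltonian vector of a is
   V_a = d_X (rho_X (delta_X a)), which is tangent to the gauge orbit. Expanding
   delta_X a in dual bases of L^0 and B^1 shows that Pi is polynomial in X, with
   derivative along Y
     - ([Y, rho delta b], a) + ([Y, rho delta a], b) + (Y, delta a /\ delta b).
   For Y = V_c the cyclic sum over a, b, c equals (1 + k_X) times the cyclic sum
   of (rho [alpha, beta], gamma), with alpha = delta a etc.; by the order-two
   identity the latter is -(X, delta (alpha /\ beta /\ gamma)), which vanishes
   because d_X X = 0.
   In a chart phi the bivector induced by Pi has a Jacobiator that depends only on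
   the gradients of the three functions (symmetry of second derivatives), so it
   suffices to evaluate it on the functions u |-> (phi u, a).
   That the orbit stays in MC follows from the linear equation F' = [F, lam]
   satisfied by the curvature F = d gamma + 1/2 [gamma, gamma] along a gauge
   flow line. *)
Require Import Defs.
From mathcomp Require Import all_boot all_order all_algebra.
From mathcomp Require Import all_classical all_reals all_analysis complex.
From mathcomp Require Import ring lra.
Import Order.TTheory GRing.Theory Num.Theory.
Import numFieldNormedType.Exports.
Import VectorInternalTheory.
Set Implicit Arguments.
Unset Strict Implicit.
Unset Printing Implicit Defensive.
Local Open Scope classical_set_scope.
Local Open Scope ring_scope.

(** * Linear subspaces given by predicates, and dual families *)

Section LinearAlgebra.
Context {k : fieldType}.

(** Among the subspaces contained in [S] take one of maximal dimension: a vector of [S] outside it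
    could be adjoined, contradicting maximality. *)
Lemma submod_vspace (V : vectType k) (S : set V) : S 0 ->
  (forall (c : k) u v, S u -> S v -> S (c *: u + v)) ->
  exists U : {vspace V}, forall v, (v \in U) <-> S v.
Proof.
move=> S0 SL.
pose P d := `[< exists2 U : {vspace V}, (forall v, v \in U -> S v) & \dim U = d >].
have exP : exists d, P d.
  exists 0%N; apply/asboolP; exists 0%VS; last by rewrite dimv0.
  by move=> v; rewrite memv0 => /eqP ->.
have bndP d : P d -> (d <= \dim {: V})%N.
  by move=> /asboolP[U _ <-]; rewrite dimvS// subvf.
case: (ex_maxnP exP bndP) => d /asboolP[U US dU] maxd.
exists U => v; split; first exact: US.
move=> Sv; apply: contrapT => /negP vU.
have : P (\dim (<[v]> + U)%VS).
  apply/asboolP; exists (<[v]> + U)%VS => // w /memv_addP[x /vlineP[c ->] [y yU ->]].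
  exact/SL/US.
move=> /maxd; rewrite -dU => dle.
have : (U == <[v]> + U)%VS.
  by rewrite eqEdim addvSr dle.
move=> /eqP UE; move: vU; rewrite UE.
by rewrite memvE addvSl.
Qed.

(** Functionals that are linearly independent on [S] evaluate [S] onto k^n, since a proper image
    would satisfy a nontrivial linear relation. Preimages of the unit vectors form the dual
    family. *)
Lemma dual_family (B : lmodType k) (S : set B) n (l : 'I_n -> B -> k) :
  S 0 -> (forall (c : k) u v, S u -> S v -> S (c *: u + v)) ->
  (forall i (c : k) u v, l i (c *: u + v) = c * l i u + l i v) ->
  (forall c : 'rV[k]_n, (forall b, S b -> \sum_i c 0 i * l i b = 0) -> c = 0) ->
  exists2 eps : 'I_n -> B, (forall i, S (eps i)) &
    forall i j, l i (eps j) = (i == j)%:R.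
Proof.
move=> S0 SL ll lfree.
pose ev (b : B) : 'rV[k]_n := \row_i l i b.
have ev0 : ev 0 = 0.
  apply/rowP => i; rewrite !mxE.
  have := ll i 1 0 0; rewrite scaler0 addr0 mul1r => h.
  by apply: (addrI (l i 0)); rewrite addr0 -h.
pose I : set 'rV[k]_n := [set v | exists2 b, S b & ev b = v].
have [||U UI] := @submod_vspace _ I.
- by exists 0.
- move=> c _ _ [b Sb <-] [b' Sb' <-]; exists (c *: b + b'); first exact: SL.
  by apply/rowP => i; rewrite !mxE ll.
have UT v : v \in U.
  suff -> : U = fullv by rewrite memvf.
  apply/eqP; rewrite eqEdim subvf dimvf /= [dim _]mul1n leqNgt.
  apply/negP => dlt.
  (* The rows of [W] span the image; having fewer than n rows, [W] is annihilated by a nonzero [c],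
     which is a relation between the [l i]. *)
  pose W := \matrix_(i < \dim U) ((vbasis U)`_i : 'rV[k]_n).
  have kW : kermx W^T != 0.
    rewrite -mxrank_eq0 mxrank_ker -lt0n subn_gt0.
    exact: leq_ltn_trans (rank_leq_col _) dlt.
  have /rowV0Pn[c /sub_kermxP cW /eqP] := kW; apply.
  apply: lfree => b Sb.
  have evU : ev b \in U by apply/UI; exists b.
  have : c *m (ev b)^T = 0.
    rewrite (coord_vbasis evU) linear_sum/= mulmx_sumr big1// => j _.
    rewrite linearZ/= -scalemxAr.
    have /rowP/(_ j) := cW; rewrite !mxE => cWj.
    apply/matrixP => i' j'; rewrite !ord1 !mxE -[RHS](mulr0 (coord (vbasis U) j (ev b))).
    by congr (_ * _); rewrite -[RHS]cWj; apply: eq_bigr => i _; rewrite !mxE.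
  move=> /matrixP/(_ 0 0); rewrite !mxE => h; rewrite -[RHS]h.
  by apply: eq_bigr => j _; rewrite !mxE.
have : forall j, exists b, S b /\ ev b = delta_mx 0 j.
  by move=> j; have /UI[b Sb be] := UT (delta_mx 0 j); exists b.
move=> /choice[eps h]; exists eps => [i|i j]; first by have [] := h i.
by have [_ /rowP/(_ i)] := h j; rewrite !mxE.
Qed.

End LinearAlgebra.

(** * The Poisson tensor at a Maurer-Cartan element *)

Section Twist.
Context {k : fieldType} {L : lmodType k} (D : dgla L).

Lemma twist_deg i X x : D 1 X -> D i x -> D (i + 1) (twist D X x).
Proof.
move=> X1 xi; rewrite /twist -[dgla_d D x]scale1r; apply: gr_linear.
  exact: dgla_d_deg.
by rewrite addrC; apply: dgla_br_deg.
Qed.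

Lemma dgla_anti0 i x y : D 0 x -> D i y -> dgla_br D y x = - dgla_br D x y.
Proof. by move=> x0 yi; rewrite (dgla_anti yi x0) mulr0 expr0z scale1r. Qed.

(** Leibniz rule for d plus Jacobi identity for [X, -]; the degree 0 of [c] removes the signs. *)
Lemma twist_br i X c x : D 1 X -> D 0 c -> D i x ->
  twist D X (dgla_br D c x) =
  dgla_br D (twist D X c) x + dgla_br D c (twist D X x).
Proof.
move=> X1 c0 xi; rewrite /twist (dgla_leibniz x c0) (dgla_jacobi X1 c0 xi).
by rewrite mulr0 !expr0z !scale1r linearDl linearDr addrACA.
Qed.

End Twist.

Section MCP.
Context {k : fieldType} {L B : lmodType k} (M : mcp L B) (X : L).
Hypothesis hX : MC M X.

Local Notation delta := (mcp_delta M X).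
Local Notation rho := (rho_of M (mcp_alg M) (mcp_pair M) X).
Local Notation "x ∧ y" := (wedge (mcp_alg M) x y) (at level 40).
Local Notation pair := (mcp_pair M).
Local Notation Dd := (twist M X).
Local Notation bv a b := (bv_bracket (mcp_alg M) delta 1 a b).

Let X1 : M 1 X. Proof. by have [] := hX. Qed.

Lemma pair_delta x a : pair (Dd x) a = pair x (delta a).
Proof. exact: mcp_adjoint. Qed.

Lemma delta_deg a : mcp_alg M 2 a -> mcp_alg M 1 (delta a).
Proof. exact: (bv_deg (mcp_BV hX)). Qed.

Lemma deltaP (c : k) a b : delta (c *: a + b) = c *: delta a + delta b.
Proof. exact: (bv_linear (mcp_BV hX)). Qed.

Lemma deltaN a : delta (- a) = - delta a.
Proof.
have d0 : delta 0 = 0.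
  by have /esym := deltaP 1 0 0; rewrite scaler0 addr0 scale1r -[RHS]addr0 => /addrI.
by rewrite -scaleN1r -[_ *: a]addr0 deltaP d0 addr0 scaleN1r.
Qed.

Lemma rho_deg a : mcp_alg M 1 a -> M 0 (rho a).
Proof. by move=> /(mcp_rho_spec hX)[]. Qed.

Lemma pair_rho a b : mcp_alg M 1 a -> mcp_alg M 1 b ->
  pair X (a ∧ b) = pair (rho a) b.
Proof. by move=> /(mcp_rho_spec hX)[_]; apply. Qed.

Lemma wedge_anti1 a b : mcp_alg M 1 a -> mcp_alg M 1 b -> b ∧ a = - (a ∧ b).
Proof. by move=> a1 b1; rewrite (wedge_comm b1 a1) mulr1 expr1z scaleN1r. Qed.

Lemma Pi_anti a b : mcp_alg M 2 a -> mcp_alg M 2 b ->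
  mcp_Pi M X b a = - mcp_Pi M X a b.
Proof.
move=> /delta_deg a1 /delta_deg b1; rewrite /mcp_Pi.
by rewrite (wedge_anti1 a1 b1) linearNr.
Qed.

(** Thus [delta a] depends only on the restriction of [a] to the tangent space of the orbit. This
    gives both the tangency of Pi and its expansion in a tangent frame. *)
Lemma delta_annihilator a : mcp_alg M 2 a ->
  (forall x, M 0 x -> pair (Dd x) a = 0) -> delta a = 0.
Proof.
move=> a2 aT; apply: (@mcp_nondegr _ _ _ M 0); first exact: delta_deg.
by move=> x x0; rewrite -pair_delta; apply: aT.
Qed.

(** Identifies d_X (rho_X (delta_X a)) as the contraction of Pi_X with [a], the Hamiltonian vector
    of [a]. *)
Lemma Pi_hamiltonian a b : mcp_alg M 2 a -> mcp_alg M 2 b ->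
  mcp_Pi M X a b = pair (Dd (rho (delta a))) b.
Proof.
by move=> /delta_deg a1 /delta_deg b1; rewrite /mcp_Pi pair_rho// pair_delta.
Qed.

Lemma delta_sq a : delta (delta a) = 0.
Proof. exact: (bv_sq (mcp_BV hX)). Qed.

Lemma bv_closed a b : delta a = 0 -> delta b = 0 -> bv a b = - delta (a ∧ b).
Proof.
move=> a0 b0; rewrite /bv_bracket a0 b0 linear0l linear0r scaler0 !subr0.
by rewrite expr1z scaleN1r.
Qed.

Lemma bv_deg1 a b : mcp_alg M 1 a -> mcp_alg M 1 b -> delta a = 0 ->
  delta b = 0 -> mcp_alg M 1 (bv a b).
Proof.
move=> a1 b1 a0 b0; rewrite (bv_closed a0 b0) -scaleN1r -[X in mcp_alg M _ X]addr0.
apply: gr_linear; last exact: gr0.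
by apply: delta_deg; exact: (wedge_deg a1 b1).
Qed.

Lemma delta_order2 a b c :
  mcp_alg M 1 a -> mcp_alg M 1 b -> mcp_alg M 1 c ->
  delta a = 0 -> delta b = 0 -> delta c = 0 ->
  delta ((a ∧ b) ∧ c) =
    delta (a ∧ b) ∧ c - a ∧ delta (b ∧ c) + b ∧ delta (a ∧ c).
Proof.
move=> a1 b1 c1 a0 b0 c0.
have E : is_BV (mcp_alg M) delta := mcp_BV hX.
have := bv_order2 E a1 b1 c1.
(* In degrees 1, 1, 1 the exponent (i + 1) * j is 2, so that sign is +1, while (-1) ^ i is -1. *)
rewrite a0 b0 c0 !(linear0l, linear0r) !scaler0 !addr0.
rewrite (_ : (1 + 1) * 1 = 2%:Z)// expr1z !scaleN1r -exprnP sqrrN expr1n scale1r opprK.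
move=> h; apply: subr0_eq; rewrite -[RHS]h.
by rewrite !opprD !opprK !addrA.
Qed.

(* The order-two identity exhibits the cyclic sum as [(X, delta (...))], which
   is [(d_X X, ...) = 0]. *)
Lemma rho_bv_cyclic a b c :
  mcp_alg M 1 a -> mcp_alg M 1 b -> mcp_alg M 1 c ->
  delta a = 0 -> delta b = 0 -> delta c = 0 ->
  pair (rho (bv a b)) c + pair (rho (bv b c)) a + pair (rho (bv c a)) b = 0.
Proof.
move=> a1 b1 c1 a0 b0 c0.
have bvab := bv_deg1 a1 b1 a0 b0.
have bvbc := bv_deg1 b1 c1 b0 c0.
have bvca := bv_deg1 c1 a1 c0 a0.
rewrite -!pair_rho// -!linearDr.
suff -> : bv a b ∧ c + bv b c ∧ a + bv c a ∧ b = - delta ((a ∧ b) ∧ c).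
  by rewrite linearNr -pair_delta (mcp_flat hX) linear0l oppr0.
rewrite delta_order2// (wedge_anti1 a1 bvbc) (wedge_anti1 b1 bvca).
rewrite !bv_closed// (wedge_anti1 c1 a1) deltaN.
by rewrite !(linearNl, linearNr) !opprD !opprK.
Qed.

(* The derivative of [Y |-> Pi_Y(a, b)] at [X]: see [derive_Pi] below. *)
Definition dPi (Y : L) (a b : B) : k :=
  - pair (dgla_br M Y (rho (delta b))) a + pair (dgla_br M Y (rho (delta a))) b
  + pair Y (delta a ∧ delta b).

(** The infinitesimal Jacobi identity. The six bracket terms combine in pairs into k_X times a
    cyclic sum, the three wedge terms give the same cyclic sum once more, and [rho_bv_cyclic] makes
    it vanish. *)
Lemma dPi_cyclic a b c :
  mcp_alg M 2 a -> mcp_alg M 2 b -> mcp_alg M 2 c ->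
  dPi (Dd (rho (delta c))) a b + dPi (Dd (rho (delta a))) b c
  + dPi (Dd (rho (delta b))) c a = 0.
Proof.
move=> a2 b2 c2; rewrite /dPi !pair_delta.
have [a1 b1 c1] : [/\ mcp_alg M 1 (delta a), mcp_alg M 1 (delta b)
  & mcp_alg M 1 (delta c)] by split; exact: delta_deg.
have [kX hk] := mcp_rho_br hX.
(* The derivation property of d_X merges two bracket terms into one containing [x, y], which
   condition (3) on rho then evaluates. *)
have pd x y z : M 0 x -> M 0 y ->
    pair (dgla_br M (Dd x) y) z - pair (dgla_br M (Dd y) x) z =
    pair (dgla_br M x y) (delta z).
  move=> x0 y0; rewrite -pair_delta (twist_br X1 x0 y0) linearDl.
  by rewrite (dgla_anti0 x0 (twist_deg X1 y0)) linearNl opprK !linearDl.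
have hkp x y z : mcp_alg M 1 x -> mcp_alg M 1 y ->
    pair (dgla_br M (rho x) (rho y)) z = kX * pair (rho (bv x y)) z.
  by move=> x1 y1; rewrite hk// linearZl_LR.
(* The wedge terms: [delta] of a product of closed elements is minus their BV bracket, and a second
   sign comes from exchanging the factors of the wedge. *)
have pbv x y z : mcp_alg M 2 x -> mcp_alg M 2 y -> mcp_alg M 1 z ->
    pair (rho z) (delta (delta x ∧ delta y)) = pair (rho (bv (delta x) (delta y))) z.
  move=> /delta_deg x1 /delta_deg y1 z1.
  have bvxy := bv_deg1 x1 y1 (delta_sq _) (delta_sq _).
  rewrite -(pair_rho bvxy z1) (wedge_anti1 z1 bvxy) linearNr (pair_rho z1 bvxy).
  by rewrite bv_closed ?delta_sq// linearNr opprK.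
have := rho_bv_cyclic a1 b1 c1 (delta_sq _) (delta_sq _) (delta_sq _).
have := pd _ _ a (rho_deg b1) (rho_deg c1).
have := pd _ _ b (rho_deg c1) (rho_deg a1).
have := pd _ _ c (rho_deg a1) (rho_deg b1).
rewrite !hkp// !pbv//.
set p1 := pair (rho _) (delta c); set p2 := pair (rho _) (delta a).
set p3 := pair (rho _) (delta b).
move=> e3 e2 e1 e0.
have -> : 0 = (1 + kX) * (p1 + p2 + p3) by rewrite e0 mulr0.
rewrite mulrDl mul1r !mulrDr -e1 -e2 -e3.
ring.
Qed.

End MCP.

Lemma scaleoE (k : fieldType) (c : k) (x : k^o) : c *: x = c * x.
Proof. by []. Qed.

(** * Dual bases of L^0 and B^1, and polynomiality of Pi *)

Section DualBases.
Context {k : fieldType} {L : vectType k} {B : lmodType k} (M : mcp L B).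
Local Notation "x ∧ y" := (wedge (mcp_alg M) x y) (at level 40).
Local Notation pair := (mcp_pair M).

(** Non-degeneracy on the left makes a basis of L^0 independent as functionals on B^1, which yields
    the dual family [eps]; non-degeneracy on the right shows that [eps] spans B^1. *)
Lemma dual_bases : exists n (e : 'I_n -> L) (eps : 'I_n -> B),
  [/\ forall s, M 0 (e s), forall s, mcp_alg M 1 (eps s),
      forall x, M 0 x -> x = \sum_s pair x (eps s) *: e s &
      forall b, mcp_alg M 1 b -> b = \sum_s pair (e s) b *: eps s].
Proof.
have [U UE] := submod_vspace (gr0 M 0) (@gr_linear _ _ M 0).
pose e (s : 'I_(\dim U)) := (vbasis U)`_s.
have e0 s : M 0 (e s) by apply/UE/vbasis_mem/mem_nth; rewrite size_tuple.
have lin (s : 'I_(\dim U)) (c : k) u v :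
    pair (e s) (c *: u + v) = c * pair (e s) u + pair (e s) v.
  by rewrite linearPr.
have sumU (c : 'I_(\dim U) -> k) : M 0 (\sum_s c s *: e s).
  by apply/UE/memv_suml => s _; apply/memvZ/UE.
have [|eps eps1 epsE] := @dual_family _ B (mcp_alg M 1) _ (pair \o e)
  (gr0 _ _) (@gr_linear _ _ (mcp_alg M) 1) lin.
  move=> c ce; apply/rowP => s; rewrite mxE.
  have /freeP/(_ (c 0)) h := basis_free (vbasisP U); apply: h.
  apply: (@mcp_nondegl _ _ _ M 0); first exact: sumU.
  move=> b b1; rewrite linear_sumlz -[RHS](ce _ b1).
  by apply: eq_bigr => i _; rewrite linearZl_LR.
have {}epsE s t : pair (e s) (eps t) = (s == t)%:R := epsE s t.
have xE x : M 0 x -> x = \sum_s coord (vbasis U) s x *: e s.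
  by move=> /UE xU; apply: coord_vbasis.
exists (\dim U), e, eps; split=> // [x x0|b b1].
  rewrite {1}(xE x x0); apply: eq_bigr => s _; congr (_ *: _).
  rewrite {2}(xE x x0) linear_sumlz (bigD1 s)//= big1 ?addr0.
    by rewrite linearZl_LR epsE eqxx /= [_ *: _]mulr1.
  by move=> t ts; rewrite linearZl_LR epsE (negbTE ts) scaler0.
apply: subr0_eq; apply: (@mcp_nondegr _ _ _ M 0).
  rewrite [b - _]addrC -scaleN1r; apply: gr_linear => //.
  elim/big_ind: _ => [|u v u1 v1|s _]; first exact: gr0.
    by rewrite -[u]scale1r; apply: gr_linear.
  by rewrite -[_ *: _]addr0; apply: gr_linear => //; apply: gr0.
move=> x x0; rewrite (xE x x0) linear_sumlz big1// => s _.
rewrite linearZl_LR linearBr linear_sumr (bigD1 s)//= big1 ?addr0.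
  rewrite linearZr_LR epsE eqxx; set p := pair (e s) b.
  by rewrite [p *: _]mulr1 subrr scaler0.
by move=> t ts; rewrite linearZr_LR epsE eq_sym (negbTE ts) scaler0.
Qed.

(** Substitute delta_X a = sum_s (d_X e_s, a) eps_s. The data [e] and [c] are independent of X, a
    and b, so Pi is given on MC by one polynomial in X, and [dPi] is its formal derivative by the
    product rule. *)
Lemma Pi_polynomial : exists n (e : 'I_n -> L) (c : 'I_n -> 'I_n -> B),
  forall X a b, MC M X -> mcp_alg M 2 a -> mcp_alg M 2 b ->
  mcp_Pi M X a b = \sum_s \sum_t
     pair (twist M X (e s)) a * pair (twist M X (e t)) b * pair X (c s t)
  /\ forall Y, dPi M X Y a b = \sum_s \sum_t
     (pair (dgla_br M Y (e s)) a * pair (twist M X (e t)) b * pair X (c s t)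
    + pair (twist M X (e s)) a * pair (dgla_br M Y (e t)) b * pair X (c s t)
    + pair (twist M X (e s)) a * pair (twist M X (e t)) b * pair Y (c s t)).
Proof.
have [n [e [eps [e0 eps1 eE epsE]]]] := dual_bases.
exists n, e, (fun s t => eps s ∧ eps t) => X a b hX a2 b2.
have a1 := delta_deg hX a2; have b1 := delta_deg hX b2.
have W Y : pair Y (mcp_delta M X a ∧ mcp_delta M X b) = \sum_s \sum_t
     pair (twist M X (e s)) a * pair (twist M X (e t)) b * pair Y (eps s ∧ eps t).
  rewrite (epsE _ a1) linear_sumlz linear_sumr; apply: eq_bigr => s _.
  rewrite (epsE _ b1) linear_sumr linear_sumr; apply: eq_bigr => t _.
  rewrite linearZl_LR linearZr_LR !linearZr_LR !(pair_delta hX).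
  by rewrite !scaleoE; ring.
split; first exact: W.
move=> Y; rewrite /dPi W.
under [RHS]eq_bigr do rewrite !big_split.
rewrite !big_split/=; congr (_ + _ + _).
(* The coefficient of [e s] in rho (delta b) is (X, delta b ∧ eps s); exchanging the factors absorbs
   the minus sign in [dPi]. *)
- rewrite {1}(eE _ (rho_deg hX b1)) linear_sumr linear_sumlz -sumrN.
  apply: eq_bigr => s _.
  rewrite linearZr_LR linearZl_LR -(pair_rho hX b1 (eps1 s)).
  rewrite (wedge_anti1 (eps1 s) b1) linearNr.
  rewrite {1}(epsE _ b1) linear_sumr linear_sumr scaleoE mulNr opprK mulr_suml.
  apply: eq_bigr => t _; rewrite !linearZr_LR (pair_delta hX) !scaleoE.
  ring.
- rewrite exchange_big/= {1}(eE _ (rho_deg hX a1)) linear_sumr linear_sumlz.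
  apply: eq_bigr => s _.
  rewrite linearZr_LR linearZl_LR -(pair_rho hX a1 (eps1 s)).
  rewrite {1}(epsE _ a1) linear_sumlz linear_sumr scaleoE mulr_suml.
  apply: eq_bigr => t _; rewrite linearZl_LR !linearZr_LR (pair_delta hX) !scaleoE.
  ring.
Qed.

End DualBases.

(** * Real and complex calculus *)

(* A finite-dimensional real coordinate system on the scalar field, compatible
   with the norm; this is all that is used of [k = R] or [k = R[i]]. *)
Record realification (R : realType) (k : numFieldType) := Realification {
  rf_dim : nat;
  rf_emb : {rmorphism R -> k};
  rf_re : 'I_rf_dim -> {additive k -> R};
  rf_basis : 'I_rf_dim -> k;
  rf_emb_norm : forall s, `|rf_emb s| = rf_emb `|s|;
  rf_emb_lt : forall s t, (rf_emb s < rf_emb t) = (s < t);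
  rf_emb_pos : forall e : k, 0 < e -> exists s, e = rf_emb s;
  rf_reM : forall j s z, rf_re j (rf_emb s * z) = s * rf_re j z;
  rf_re_norm : forall j z, rf_emb `|rf_re j z| <= `|z|;
  rf_expand : forall z, z = \sum_j rf_emb (rf_re j z) * rf_basis j
}.

Lemma realification_real (R : realType) : realification R R.
Proof.
apply: (@Realification R R 1 idfun (fun=> idfun) (fun=> 1)) => //=.
- by move=> e _; exists e.
- by move=> z; rewrite big_ord1 mulr1.
Qed.

Lemma realification_complex (R : realType) : realification R R[i].
Proof.
apply: (@Realification R R[i] 2 (real_complex R)
  (fun j => if j == 0 then (@complex.Re R : {additive _ -> _})
            else (@complex.Im R : {additive _ -> _}))
  (fun j => if j == 0 then 1 else 'i%C)).
- by move=> s; rewrite normc_def /= expr0n addr0 sqrtr_sqr.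
- by move=> s t; rewrite ltcR.
- move=> e e0; exists (complex.Re e); move: e0; case: e => a b.
  by rewrite ltcE /= => /andP[/eqP -> _].
- by move=> j s [a b]; case: ifP => _ /=; rewrite mul0r ?subr0 ?addr0.
- move=> j z; case: ifP => _; rewrite normc_def lecR.
  + by rewrite -sqrtr_sqr ler_wsqrtr// lerDl sqr_ge0.
  + by rewrite -sqrtr_sqr ler_wsqrtr// lerDr sqr_ge0.
- move=> [a b]; rewrite big_ord_recl big_ord1 /= mulr1.
  by apply/eqP; rewrite eq_complex /= !mul0r !mulr1 mulr0 subr0 !addr0 add0r !eqxx.
Qed.

Section Realification.
Context {R : realType} {k : numFieldType} (rf : realification R k).
Local Notation emb := (rf_emb rf).
Local Notation re := (rf_re (r := rf)).

(** Passes from a derivative over k to a real one along a line: [re j] commutes with real scalars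
    and does not increase norms, so it preserves limits of difference quotients. *)
Lemma is_derive_re (V : normedModType k) (F : V -> k^o) (x v : V) df j (s : R) :
  is_derive (x + emb s *: v) v F df ->
  is_derive s 1 (fun t : R => re j (F (x + emb t *: v))) (re j df).
Proof.
move=> [dF dFE].
have : h^-1 *: (F (h *: v + (x + emb s *: v)) - F (x + emb s *: v)) @[h --> 0^'] --> df.
  by rewrite -dFE; apply: dF.
move=> /cvgrPdist_lt dFc.
have key : (fun h : R => h^-1 *: (re j (F (x + emb (h *: 1 + s) *: v)) -
    re j (F (x + emb s *: v)))) @ 0^' --> re j df.
  apply/cvgrPdist_lt => e e0.
  have /dFc : 0 < emb e by rewrite -(rmorph0 emb) rf_emb_lt.
  move=> /nbhs_ballP[d /= d0 hd].
  have [d' dE] := rf_emb_pos rf d0.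
  have d'0 : 0 < d' by rewrite -(rf_emb_lt rf) -dE rmorph0.
  apply/nbhs_ballP; exists d' => //= t.
  rewrite /ball/= sub0r normrN => td t0.
  have := hd (emb t); rewrite /ball /= sub0r normrN rf_emb_norm dE rf_emb_lt => /(_ td).
  have et0 : emb t != 0 by rewrite fmorph_eq0.
  move=> /(_ et0) H.
  rewrite -(rf_emb_lt rf) (le_lt_trans _ H)//.
  rewrite -raddfB -[_ *: re j _]/(_ * _) -rf_reM -raddfB.
  apply: le_trans; first exact: rf_re_norm.
  rewrite fmorphV.
  rewrite le_eqVlt; apply/orP; left; apply/eqP.
  congr (`| _ - _ * (F _ - _) |).
  by rewrite [t%:A]mulr1 rmorphD scalerDl addrCA.
split; first by apply/cvg_ex; exists (re j df).
by apply/cvg_lim.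
Qed.

End Realification.

Section DerivationRules.
Context {k : numFieldType} {V W : normedModType k}.

Lemma is_derive_bigsum (I : Type) (r : seq I) (h : I -> V -> W) (dh : I -> W)
    (x v : V) : (forall i, is_derive x v (h i) (dh i)) ->
  is_derive x v (fun y => \sum_(i <- r) h i y) (\sum_(i <- r) dh i).
Proof.
move=> hd; elim: r => [|i r IHr].
  rewrite big_nil (_ : (fun y => _) = cst 0); first exact: is_derive_cst.
  by apply/funext => y; rewrite big_nil.
rewrite big_cons (_ : (fun y => _) = h i + (fun y => \sum_(i <- r) h i y)).
  exact: is_deriveD.
by apply/funext => y; rewrite big_cons.
Qed.

Lemma is_derive_mul (f g : V -> k^o) (x v : V) (df dg : k) :
  is_derive x v f df -> is_derive x v g dg ->
  is_derive x v (fun y => f y * g y : k^o) (f x * dg + g x * df).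
Proof. by move=> hf hg; apply: (is_derive_eq (is_deriveM hf hg)). Qed.

Lemma is_derive_mulr_cst (f : V -> k^o) (x v : V) (df c : k) :
  is_derive x v f df -> is_derive x v (fun y => f y * c : k^o) (df * c).
Proof.
move=> hf; apply: (is_derive_eq (is_derive_mul hf (is_derive_cst (c : k^o) x v))).
by rewrite mulr0 add0r mulrC.
Qed.

End DerivationRules.

(** * Uniqueness for linear differential equations *)

Section LinearODE.

(** Energy estimate: the sum of squares E satisfies E' <= K E, so exp (-K t) E does not increase; it
    starts at 0 and is nonnegative. *)
Lemma real_linear_ode (R : realType) (I : finType) (u : I -> R -> R)
    (A : I -> I -> R) :
  (forall i (t : R), is_derive t 1 (u i) (\sum_j A i j * u j t)) ->
  (forall i, u i 0 = 0) -> forall i, u i 1 = 0.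
Proof.
move=> ud u0.
pose E (t : R) := \sum_i u i t * u i t.
pose K : R := \sum_i \sum_j (`|A i j| *+ 2).
pose H (t : R) : R := expR (- K * t) * E t.
have E_ge i t : u i t * u i t <= E t.
  by rewrite /E (bigD1 i)//= lerDl sumr_ge0// => j _; rewrite -expr2 sqr_ge0.
have Ed (t : R) : is_derive t 1 E (\sum_i (u i t * (\sum_j A i j * u j t) *+ 2)).
  apply: is_derive_eq.
    apply: is_derive_bigsum => i; apply: is_derive_mul; exact: ud.
  by apply: eq_bigr => i _; rewrite mulr2n.
have Ed_le (t : R) : \sum_i (u i t * (\sum_j A i j * u j t) *+ 2) <= K * E t.
  rewrite /K mulr_suml; apply: ler_sum => i _.
  rewrite mulr_suml mulr_sumr -sumrMnl; apply: ler_sum => j _.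
  have h1 := E_ge i t; have h2 := E_ge j t.
  (* From (u_i + u_j)^2 >= 0 and (u_i - u_j)^2 >= 0 one gets |u_i u_j| <= E. *)
  have : A i j * (u i t * u j t) <= `|A i j| * E t.
    apply: le_trans (ler_norm _) _; rewrite normrM ler_wpM2l//.
    rewrite ler_norml; apply/andP; split.
    - have := sqr_ge0 (u i t + u j t); nra.
    - have := sqr_ge0 (u i t - u j t); nra.
  by rewrite mulrCA mulrnAl; lra.
have Hd (t : R) : is_derive t 1 H (expR (- K * t) *
    (\sum_i (u i t * (\sum_j A i j * u j t) *+ 2) - K * E t)).
  have hl : is_derive t 1 (fun s : R => - K * s) (- K).
    have -> : (fun s : R => - K * s) = (- K) *: (@id R) by [].
    by apply: (is_derive_eq (is_deriveZ _ _)); rewrite [_ *: _]mulr1.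
  have he := is_derive1_comp (is_derive_expR (- K * t)) hl.
  apply: (is_derive_eq (is_derive_mul he (Ed t))).
  by rewrite /comp mulrBr; ring.
have H_le : H 1 <= H 0.
  apply: (@ler0_derive1_nincr _ H 0 1) => //.
  - move=> x _; rewrite derive1E; have [_ ->] := Hd x.
    by rewrite pmulr_rle0 ?expR_gt0// subr_le0.
  - apply: derivable_within_continuous => x _; by have [] := Hd x.
have H0 : H 0 = 0.
  by rewrite /H /E big1 ?mulr0// => i _; rewrite u0 mulr0.
move=> i; have := E_ge i 1.
move: H_le; rewrite H0 /H pmulr_rle0 ?expR_gt0// => E1 ui.
have := le_trans ui E1; rewrite -expr2 => h.
by apply/eqP; rewrite -sqrf_eq0 eq_le h sqr_ge0.
Qed.

Lemma is_derive_dir (k : numFieldType) (W : normedModType k) (f : k^o -> W)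
    (x t : k^o) (df : W) :
  is_derive x 1 f df -> is_derive x t f (t *: df).
Proof.
move=> [fd fE]; have /derivable1_diffP fdiff := fd.
split; first exact: diff_derivable.
by rewrite deriveE// -fE deriveE// -linearZ /= [_ *: 1]mulr1.
Qed.

(** Restricted to the segment from 0 to [t], parametrised by real s in [0, 1], the real coordinates
    of the [F i] satisfy a real linear system. *)
Lemma linear_ode (R : realType) (k : numFieldType) (rf : realification R k)
    n (F : 'I_n -> k^o -> k^o) (A : 'I_n -> 'I_n -> k) :
  (forall i (t : k^o), is_derive t 1 (F i) (\sum_j A i j * F j t)) ->
  (forall i, F i 0 = 0) -> forall i t, F i t = 0.
Proof.
move=> Fd F0 i t.
pose u (p : 'I_n * 'I_(rf_dim rf)) (s : R) := rf_re p.2 (F p.1 (0 + rf_emb rf s *: t)).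
(* The factor [t] comes from differentiating along the segment; expanding [F j] in [rf_basis] gives
   the remaining factors. *)
pose a (p q : 'I_n * 'I_(rf_dim rf)) : R :=
  rf_re p.2 (t * A p.1 q.1 * rf_basis q.2).
have ud p (s : R) : is_derive s 1 (u p) (\sum_q a p q * u q s).
  have /(is_derive_dir t) h := Fd p.1 (0 + rf_emb rf s *: t).
  apply: (is_derive_eq (is_derive_re p.2 h)).
  rewrite [_ *: _]mulr_sumr raddf_sum -(pair_bigA _ (fun j l => a p (j, l) * u (j, l) s))/=.
  apply: eq_bigr => j _.
  rewrite {1}[F j _](rf_expand rf) mulrA mulr_sumr raddf_sum.
  apply: eq_bigr => l _; rewrite mulrCA rf_reM mulrC; congr (rf_re _ _ * _).
have u0 p : u p 0 = 0 by rewrite /u rmorph0 scale0r addr0 F0 raddf0.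
rewrite (rf_expand rf (F i t)) big1// => j _.
have := real_linear_ode ud u0 (i, j).
by rewrite /u rmorph1 scale1r add0r => ->; rewrite rmorph0 mul0r.
Qed.

End LinearODE.

(** * Symmetry of second derivatives *)

Section Schwarz.

(* The second difference of [g] on a square of side [h] is a mixed derivative
   times [h ^+ 2], by two applications of the mean value theorem. *)
Lemma second_difference (R : realType) (g gx gxy : R -> R -> R) (r h : R) :
  0 < h < r ->
  (forall x y : R, `|x| < r -> `|y| < r -> is_derive x 1 (g^~ y) (gx x y)) ->
  (forall x y : R, `|x| < r -> `|y| < r -> is_derive y 1 (gx x) (gxy x y)) ->
  exists xi eta, [/\ `|xi| < r, `|eta| < r, `|xi| < h, `|eta| < h &
    g h h - g h 0 - g 0 h + g 0 0 = gxy xi eta * h * h].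
Proof.
move=> /andP[h0 hr] dx dxy.
have inr x : x \in `[0, h] -> `|x| < r.
  by rewrite in_itv/= => /andP[x0 xh]; rewrite ger0_norm// (le_lt_trans xh).
have lth x : x \in `]0, h[ -> `|x| < h.
  by rewrite in_itv/= => /andP[x0 xh]; rewrite gtr0_norm.
have oc x : x \in `]0, h[ -> x \in `[0, h].
  by rewrite !in_itv/= => /andP[x0 xh]; rewrite !ltW.
have rh : `|h| < r by rewrite gtr0_norm.
have r0 : `|0 : R| < r by rewrite normr0 (lt_trans h0).
pose phi (x : R) : R := g x h - g x 0.
pose dphi (x : R) : R := gx x h - gx x 0.
have phid (x : R) : x \in `[0, h] -> is_derive x 1 phi (dphi x).
  by move=> /inr xr; apply: is_deriveB; exact: dx.
have phic : {within `[0, h], continuous phi}.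
  by apply: derivable_within_continuous => x /phid[].
have [xi xi0h hxi] := MVT h0 (fun x xh => phid x (oc x xh)) phic.
have gxd (y : R) : y \in `[0, h] -> is_derive y 1 (gx xi) (gxy xi y).
  by move=> /inr yr; apply: dxy => //; exact/inr/oc.
have gxc : {within `[0, h], continuous (gx xi)}.
  by apply: derivable_within_continuous => y /gxd[].
have [eta eta0h heta] := MVT h0 (fun y yh => gxd y (oc y yh)) gxc.
exists xi, eta; split; [exact/inr/oc|exact/inr/oc|exact: lth|exact: lth|].
by move: hxi; rewrite /phi /dphi heta !subr0 => <-; ring.
Qed.

(** Both mixed derivatives, each at some point within h of the origin in either coordinate, equal
    the same second difference divided by h^2; continuity at the origin finishes. *)
Lemma real_schwarz (R : realType) (g gx gy gxy gyx : R -> R -> R) (r : R) :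
  0 < r ->
  (forall x y : R, `|x| < r -> `|y| < r -> is_derive x 1 (g^~ y) (gx x y)) ->
  (forall x y : R, `|x| < r -> `|y| < r -> is_derive y 1 (g x) (gy x y)) ->
  (forall x y : R, `|x| < r -> `|y| < r -> is_derive y 1 (gx x) (gxy x y)) ->
  (forall x y : R, `|x| < r -> `|y| < r -> is_derive x 1 (gy^~ y) (gyx x y)) ->
  (forall e : R, 0 < e -> exists2 d : R, 0 < d & forall x y, `|x| < d -> `|y| < d ->
    `|gxy 0 0 - gxy x y| < e) ->
  (forall e : R, 0 < e -> exists2 d : R, 0 < d & forall x y, `|x| < d -> `|y| < d ->
    `|gyx 0 0 - gyx x y| < e) ->
  gxy 0 0 = gyx 0 0.
Proof.
move=> r0 dx dy dxy dyx cxy cyx.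
apply: subr0_eq; apply/eqP; rewrite -normr_eq0; apply/eqP/le_anti.
rewrite normr_ge0 andbT; apply/ler_addgt0Pl => e e0; rewrite addr0.
have e20 : 0 < e / 2 by rewrite divr_gt0.
have [d1 d10 h1] := cxy _ e20; have [d2 d20 h2] := cyx _ e20.
(* Halving makes h strictly smaller than all three radii. *)
pose h := Num.min r (Num.min d1 d2) / 2.
have m0 : 0 < Num.min r (Num.min d1 d2) by rewrite !lt_min r0 d10 d20.
have h0 : 0 < h by rewrite divr_gt0.
have hm : h < Num.min r (Num.min d1 d2) by rewrite /h; lra.
move: (hm); rewrite !lt_min => /and3P[hr hd1 hd2].
have hh : 0 < h < r by rewrite h0.
clearbody h.
have [x [y [_ _ xh yh e1]]] := second_difference hh dx dxy.
have [y' [x' [_ _ yh' xh' e2]]] := @second_difference R (fun y x => g x y)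
  (fun y x => gy x y) (fun y x => gyx x y) r h hh
  (fun y x hy hx => dy x y hx hy) (fun y x hy hx => dyx x y hx hy).
have E : gxy x y = gyx x' y'.
  apply: (@mulIf _ (h * h)); first by rewrite mulf_neq0// gt_eqF.
  by rewrite /= !mulrA -e1 -e2; ring.
have H1 := h1 _ _ (lt_trans xh hd1) (lt_trans yh hd1).
have H2 := h2 _ _ (lt_trans xh' hd2) (lt_trans yh' hd2).
rewrite (_ : _ - _ = (gxy 0 0 - gxy x y) - (gyx 0 0 - gyx x' y')).
  apply: le_trans (ler_normB _ _) _.
  by rewrite [leRHS]splitr; rewrite lerD// ltW.
by rewrite E; ring.
Qed.

(** Reduces to the real case on the two-parameter family u + x v + y w, one real coordinate of the
    scalar field at a time. *)
Lemma derive_comm (R : realType) (k : numFieldType) (rf : realification R k)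
    (V : normedModType k) (U : set V) (f : V -> k^o) (u v w : V) :
  open U -> U u -> Cn 2 U f -> 'D_w ('D_v f) u = 'D_v ('D_w f) u.
Proof.
move=> oU Uu [fd fC].
have d1 v' z : U z -> is_derive z v' f ('D_v' f z).
  by move=> Uz; apply/derivableP/diff_derivable/fd.
have d2 v' w' z : U z -> is_derive z w' ('D_v' f : V -> k^o) ('D_w' ('D_v' f) z).
  by move=> Uz; apply/derivableP/diff_derivable; have [h _] := fC v'; apply: h.
have c2 v' w' : {for u, continuous ('D_w' ('D_v' f))}.
  by have [_ h] := fC v'; apply: h.
pose p (x y : R) := u + rf_emb rf x *: v + rf_emb rf y *: w.
have nearp (P : set V) : nbhs u P ->
    exists2 r : R, 0 < r & forall x y : R, `|x| < r -> `|y| < r -> P (p x y).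
  move=> /nbhs_ballP[e /= e0 eP].
  (* The summand 1 keeps the divisor positive when v = w = 0. *)
  have N0 : 0 < `|v| + `|w| + 1 by rewrite ltr_wpDl// addr_ge0.
  have [r rE] := rf_emb_pos rf (divr_gt0 e0 N0).
  exists r; first by rewrite -(rf_emb_lt rf) -rE rmorph0 divr_gt0.
  move=> x y xr yr; apply: eP; rewrite -ball_normE /ball_ /= /p.
  rewrite -addrA opprD addrA subrr add0r normrN.
  apply: le_lt_trans (ler_normD _ _) _; rewrite !normrZ !rf_emb_norm.
  have -> : e = rf_emb rf r * (`|v| + `|w| + 1) by rewrite -rE divfK ?gt_eqF.
  rewrite !mulrDr mulr1 -[ltLHS]addr0; apply: ler_ltD.
    by apply: lerD; apply: ler_wpM2r => //; apply: ltW; rewrite rf_emb_lt.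
  by rewrite -rE divr_gt0.
have [r r0 pU] := nearp _ (open_nbhs_nbhs (conj oU Uu)).
have cre (G : V -> k^o) (j : 'I_(rf_dim rf)) : {for u, continuous G} -> forall e : R, 0 < e ->
    exists2 d : R, 0 < d & forall x y : R, `|x| < d -> `|y| < d ->
    `|rf_re j (G (p 0 0)) - rf_re j (G (p x y))| < e.
  move=> /cvgrPdist_lt cG e e0.
  have /cG/nearp[d d0 hd] : 0 < rf_emb rf e by rewrite -(rmorph0 (rf_emb rf)) rf_emb_lt.
  exists d => // x y xd yd; rewrite -raddfB -(rf_emb_lt rf).
  apply: le_lt_trans; first exact: rf_re_norm.
  by rewrite {1}/p !rmorph0 !scale0r !addr0; apply: hd.
have px (F : V -> k^o) dF (j : 'I_(rf_dim rf)) (x y : R) : is_derive (p x y) v F dF ->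
    is_derive x 1 (fun x => rf_re j (F (p x y))) (rf_re j dF).
  rewrite /p addrAC => /(is_derive_re j).
  by congr (is_derive _ _ _ _); apply/funext => x'; rewrite addrAC.
have py (F : V -> k^o) dF (j : 'I_(rf_dim rf)) (x y : R) : is_derive (p x y) w F dF ->
    is_derive y 1 (fun y => rf_re j (F (p x y))) (rf_re j dF).
  exact: is_derive_re.
have p0 : p 0 0 = u by rewrite /p rmorph0 !scale0r !addr0.
have E (j : 'I_(rf_dim rf)) :
    rf_re j ('D_w ('D_v f) (p 0 0)) = rf_re j ('D_v ('D_w f) (p 0 0)).
  pose g (x y : R) : R := rf_re j (f (p x y)).
  pose gx (x y : R) : R := rf_re j ('D_v f (p x y)).
  pose gy (x y : R) : R := rf_re j ('D_w f (p x y)).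
  pose gxy (x y : R) : R := rf_re j ('D_w ('D_v f) (p x y)).
  pose gyx (x y : R) : R := rf_re j ('D_v ('D_w f) (p x y)).
  apply: (@real_schwarz R g gx gy gxy gyx r r0).
  - by move=> x y xr yr; apply/px/d1/pU.
  - by move=> x y xr yr; apply/py/d1/pU.
  - move=> x y xr yr; exact: (py _ _ j x y (d2 v w _ (pU x y xr yr))).
  - move=> x y xr yr; exact: (px _ _ j x y (d2 w v _ (pU x y xr yr))).
  - exact: cre (c2 v w).
  - exact: cre (c2 w v).
rewrite p0 in E.
rewrite [LHS](rf_expand rf) [RHS](rf_expand rf).
apply: (eq_bigr _ (fun j _ => congr1 (fun z => rf_emb rf z * rf_basis j) (E j))).
Qed.

End Schwarz.

(** * Calculus of C^n maps on open sets *)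

Lemma near_eq_differentiable (k : numFieldType) (V W : normedModType k)
    (f g : V -> W) (x : V) :
  {near x, f =1 g} -> differentiable f x -> differentiable g x.
Proof.
move=> fg df; have fgx : f x = g x := nbhs_singleton fg.
have [fc fE] := (iffLR (diff_locallyP x f)) df.
have gE : g \o shift x = cst (g x) + 'd f x +o_ 0 id.
  apply/eqaddoP => e e0; have /eqaddoP/(_ e e0) := fE.
  have : \forall y \near (0 : V), f (y + x) = g (y + x).
    by move: fg; rewrite (near_shift 0 x) /=; apply: filterS => y; rewrite subr0.
  apply: filterS2 => y fgy; rewrite !fctE /= /cst.
  by rewrite -fgy -fgx.
apply/diff_locallyP; rewrite (diff_unique fc gE).
by split.
Qed.

Section Smooth.
Context {k : numFieldType} {V : normedModType k} (U : set V).
Hypothesis oU : open U.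

(** As [U] is open, derivatives at its points see only values on [U]. This allows replacing a map by
    a formula that is valid on [U] alone. *)
Lemma Cn_eq (W : normedModType k) n (f g : V -> W) :
  (forall x, U x -> f x = g x) -> Cn n U f -> Cn n U g.
Proof.
have near_eq (f1 g1 : V -> W) x : (forall y, U y -> f1 y = g1 y) -> U x ->
    {near x, f1 =1 g1}.
  move=> fg Ux; have := open_nbhs_nbhs (conj oU Ux).
  by apply: filterS => y; apply: fg.
elim: n f g => [|n IHn] f g fg /=.
  move=> fC x Ux; suff : g @ x --> g x by [].
  rewrite -(fg _ Ux).
  by apply: cvg_trans (fC x Ux); apply: near_eq_cvg; apply: near_eq => // y /fg.
move=> [fd fC]; split=> [x Ux|v].
  exact: near_eq_differentiable (near_eq _ _ _ fg Ux) (fd x Ux).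
apply: IHn (fC v) => x Ux.
by apply: near_eq_derive; apply: near_eq.
Qed.

Lemma CnW (W : normedModType k) n (f : V -> W) : Cn n.+1 U f -> Cn n U f.
Proof.
elim: n f => [|n IHn] f [fd fC].
  by move=> x Ux; apply: differentiable_continuous; apply: fd.
by split=> // v; apply: IHn.
Qed.

Lemma Cn_cst (W : normedModType k) n (w : W) : Cn n U (cst w).
Proof.
elim: n w => [|n IHn] w; first by move=> x _; apply: cst_continuous.
split=> [x _|v]; first exact: differentiable_cst.
rewrite (_ : 'D_v _ = cst 0); first exact: IHn.
by apply/funext => x; rewrite derive_cst.
Qed.

Lemma CnD (W : normedModType k) n (f g : V -> W) :
  Cn n U f -> Cn n U g -> Cn n U (fun x => f x + g x).
Proof.
elim: n f g => [|n IHn] f g.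
  by move=> fC gC x Ux; apply: continuousD; [exact: fC|exact: gC].
move=> [fd fC] [gd gC]; split=> [x Ux|v].
  by apply: differentiableD; [exact: fd|exact: gd].
apply: (Cn_eq _ (IHn _ _ (fC v) (gC v))) => x Ux.
by rewrite [RHS]deriveD//; apply: diff_derivable; [exact: fd|exact: gd].
Qed.

Lemma Cn_sum (W : normedModType k) n (I : Type) (r : seq I) (f : I -> V -> W) :
  (forall i, Cn n U (f i)) -> Cn n U (fun x => \sum_(i <- r) f i x).
Proof.
move=> fC; elim: r => [|i r IHr].
  by rewrite (_ : (fun x => _) = cst 0);
    [exact: Cn_cst|apply/funext => x; rewrite big_nil].
rewrite (_ : (fun x => _) = fun x => f i x + \sum_(i <- r) f i x).
  exact: CnD.
by apply/funext => x; rewrite big_cons.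
Qed.

Lemma CnM n (f g : V -> k^o) :
  Cn n U f -> Cn n U g -> Cn n U (fun x => f x * g x : k^o).
Proof.
elim: n f g => [|n IHn] f g.
  by move=> fC gC x Ux; apply: continuousM; [exact: fC|exact: gC].
move=> fS gS; have [fd fC] := fS; have [gd gC] := gS; split=> [x Ux|v].
  by apply: differentiableM; [exact: fd|exact: gd].
have H := CnD (IHn _ _ (CnW fS) (gC v)) (IHn _ _ (CnW gS) (fC v)).
apply: (Cn_eq _ H) => x Ux.
by rewrite [RHS]deriveM//; apply: diff_derivable; [exact: fd|exact: gd].
Qed.

Lemma Cn_prod n (I : Type) (r : seq I) (f : I -> V -> k^o) :
  (forall i, Cn n U (f i)) -> Cn n U (fun x => \prod_(i <- r) f i x : k^o).
Proof.
move=> fC; elim: r => [|i r IHr].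
  by rewrite (_ : (fun x => _) = cst 1);
    [exact: Cn_cst|apply/funext => x; rewrite big_nil].
rewrite (_ : (fun x => _) = fun x => f i x * \prod_(i <- r) f i x).
  exact: CnM.
by apply/funext => x; rewrite big_cons.
Qed.

Lemma CnV n (f : V -> k^o) : (forall x, U x -> f x != 0) ->
  Cn n U f -> Cn n U (fun x => (f x)^-1 : k^o).
Proof.
move=> f0; elim: n => [|n IHn].
  by move=> fC x Ux; apply: continuousV; [exact: f0|exact: fC].
move=> fS; have [fd fC] := fS; split=> [x Ux|v].
  by apply: differentiableV; [exact: fd|exact: f0].
have IH := IHn (CnW fS).
have H := CnM (Cn_cst n (-1 : k^o)) (CnM (CnM IH IH) (fC v)).
apply: (Cn_eq _ H) => x Ux.
rewrite [RHS]deriveV; [|exact: f0|exact/diff_derivable/fd].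
by rewrite [RHS]scaleNr mulN1r -invfM -expr2.
Qed.

Lemma CnZl (W : normedModType k) n (f : V -> k^o) (w : W) :
  Cn n U f -> Cn n U (fun x => f x *: w).
Proof.
elim: n f => [|n IHn] f.
  by move=> fC x Ux; apply: cvgZl; exact: fC.
move=> [fd fC]; split=> [x Ux|v]; first exact/differentiableZl/fd.
apply: (Cn_eq _ (IHn _ (fC v))) => x Ux.
have dfx := fd x Ux.
rewrite [RHS]deriveE; last exact: differentiableZl.
by rewrite diffZl// [LHS](_ : _ = 'd f x v *: w)// deriveE.
Qed.

Lemma derive_coord m p (F : V -> 'M[k]_(m, p)) i j x v : derivable F x v ->
  is_derive x v (fun y => F y i j : k^o) ('D_v F x i j).
Proof.
move=> Fd.
have key : h^-1 *: (F (h *: v + x) i j - F x i j : k^o) @[h --> 0^'] --> ('D_v F x i j : k^o).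
  have := cvg_comp _ _ Fd (@coord_continuous _ _ _ i j ('D_v F x)).
  apply: cvg_trans; apply: near_eq_cvg; apply: nearW => h.
  by rewrite /= !mxE.
by split; [apply/cvg_ex; exists ('D_v F x i j)|exact/cvg_lim].
Qed.

Lemma Cn_coord m p n (F : V -> 'M[k]_(m, p)) i j :
  Cn n U F -> Cn n U (fun x => F x i j : k^o).
Proof.
elim: n F => [|n IHn] F.
  move=> FC x Ux; apply: (@continuous_comp _ _ _ F (fun N : 'M[k]_(m, p) => N i j)).
    exact: FC.
  exact: coord_continuous.
move=> [Fd FC]; split=> [x Ux|v].
  apply: (@differentiable_comp _ _ _ _ F (fun N : 'M[k]_(m, p) => N i j : k^o)).
    exact: Fd.
  exact: differentiable_coord.
apply: (Cn_eq _ (IHn _ (FC v))) => x Ux.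
have /(@derive_coord _ _ _ i j)[_ ->//] := @diff_derivable _ _ _ F x v (Fd x Ux).
Qed.

Lemma Cn_mx m p n (F : V -> 'M[k]_(m, p)) :
  (forall i j, Cn n U (fun x => F x i j : k^o)) -> Cn n U F.
Proof.
move=> FC; rewrite (_ : F = fun x => \sum_i \sum_j F x i j *: delta_mx i j).
  by apply: Cn_sum => i; apply: Cn_sum => j; apply: CnZl.
by apply/funext => x; rewrite [LHS]matrix_sum_delta.
Qed.

Lemma Cn_det m n (F : V -> 'M[k]_m) :
  (forall i j, Cn n U (fun x => F x i j : k^o)) -> Cn n U (fun x => \det (F x) : k^o).
Proof.
move=> FC; rewrite /determinant; apply: Cn_sum => s.
by apply: CnM; [exact: Cn_cst|apply: Cn_prod].
Qed.

(** Cramer's rule: the entries are cofactors divided by the determinant. *)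
Lemma Cn_invmx m n (F : V -> 'M[k]_m) : (forall x, U x -> F x \in unitmx) ->
  (forall i j, Cn n U (fun x => F x i j : k^o)) ->
  forall i j, Cn n U (fun x => invmx (F x) i j : k^o).
Proof.
move=> FU FC i j.
have H : Cn n U (fun x => (\det (F x))^-1 * cofactor (F x) j i : k^o).
  apply: CnM.
    apply: CnV; last exact: Cn_det.
    by move=> x /FU; rewrite unitmxE unitfE.
  apply: CnM; first exact: Cn_cst.
  apply: Cn_det => i' j'; rewrite (_ : (fun x => _) = fun x => F x (lift j i') (lift i j')).
    exact: FC.
  by apply/funext => x; rewrite !mxE.
by apply: (Cn_eq _ H) => x Ux; rewrite /invmx FU// !mxE.
Qed.

End Smooth.

(** The conditions in [Cn] are imposed point by point on derivatives of the total map, so they may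
    be checked near one point at a time. *)
Lemma Cn_local (k : numFieldType) (V W : normedModType k) n (U : set V)
    (f : V -> W) :
  (forall x, U x -> exists2 U' : set V, U' x & Cn n U' f) -> Cn n U f.
Proof.
elim: n f => [|n IHn] f H.
  by move=> x /H[U' U'x hU']; exact: hU'.
split=> [x /H[U' U'x [h _]]|v]; first exact: h.
by apply: IHn => x /H[U' U'x [_ h]]; exists U' => //; exact: h.
Qed.

Lemma Cn_sub (k : numFieldType) (V W : normedModType k) n (U U' : set V)
    (f : V -> W) : U' `<=` U -> Cn n U f -> Cn n U' f.
Proof. by move=> UU' fC; apply: Cn_local => x /UU' Ux; exists U. Qed.

(** * Gauge orbits *)

Section Coordinates.
Context {k : numFieldType} {L : vectType k} {V : normedModType k}.

Lemma linear_coordE (l : L -> k) :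
  (forall (c : k) x y, l (c *: x + y) = c * l x + l y) ->
  forall x, l x = \sum_s v2r x 0 s * l (r2v (delta_mx 0 s)).
Proof.
move=> ll x.
have l0 : l 0 = 0.
  have /esym := ll 1 0 0; rewrite scaler0 addr0 mul1r -[RHS]addr0.
  exact: addrI.
rewrite -{1}[x]v2rK {1}(row_sum_delta (v2r x)) linear_sum /=.
elim/big_rec2: _ => [|s _ y _ <-]; first exact: l0.
by rewrite linearZ /= ll.
Qed.

Lemma is_derive_lin (l : L -> k^o) (f : V -> L) (u h : V) df :
  (forall (c : k) x y, l (c *: x + y) = c * l x + l y) ->
  is_derive u h (v2r \o f) df -> is_derive u h (l \o f) (l (r2v df)).
Proof.
move=> ll fd; rewrite (_ : l \o f =
    fun x => \sum_s v2r (f x) 0 s * l (r2v (delta_mx 0 s)) : k^o); last first.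
  by apply/funext => x /=; exact: linear_coordE.
rewrite (linear_coordE ll) r2vK.
apply: is_derive_bigsum => s; apply: is_derive_mulr_cst.
have [fd1 <-] := fd.
exact: (derive_coord 0 s fd1).
Qed.

(** Expanding the first argument in coordinates reduces this to the product rule for scalar
    functions. *)
Lemma is_derive_bilin (b : L -> L -> k^o) (f g : V -> L) (u h : V) df dg :
  (forall (c : k) x y z, b (c *: x + y) z = c * b x z + b y z) ->
  (forall (c : k) x y z, b z (c *: x + y) = c * b z x + b z y) ->
  is_derive u h (v2r \o f) df -> is_derive u h (v2r \o g) dg ->
  is_derive u h (fun x => b (f x) (g x)) (b (f u) (r2v dg) + b (r2v df) (g u)).
Proof.
move=> bl br fd gd; rewrite (_ : (fun x => b _ _) =
    fun x => \sum_s v2r (f x) 0 s * b (r2v (delta_mx 0 s)) (g x) : k^o); last first.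
  apply/funext => x; apply: (linear_coordE (l := b^~ (g x))) => c y z; exact: bl.
have hs s : is_derive u h (fun x => v2r (f x) 0 s * b (r2v (delta_mx 0 s)) (g x) : k^o)
    (v2r (f u) 0 s * b (r2v (delta_mx 0 s)) (r2v dg) +
     b (r2v (delta_mx 0 s)) (g u) * df 0 s).
  apply: is_derive_mul; last by apply: is_derive_lin => // c x y; exact: br.
  by have [fd1 <-] := fd; exact: (derive_coord 0 s fd1).
apply: (is_derive_eq (is_derive_bigsum _ hs)); rewrite big_split/=; congr (_ + _).
  by rewrite (linear_coordE (l := b^~ (r2v dg)))// => c y z; exact: bl.
rewrite (linear_coordE (l := b^~ (g u))) ?r2vK; last by move=> c y z; exact: bl.
by apply: eq_bigr => s _; rewrite mulrC.
Qed.

End Coordinates.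

Section Orbit.
Context {k : numFieldType} {L : vectType k} (D : dgla L).

Definition curvature (x : L) : L := dgla_d D x + 2%:R^-1 *: dgla_br D x x.

(* The left-hand side is the derivative of [curvature] at [x] along [w], since
   [x, w] = [w, x] in degree 1. *)
Lemma curvature_derivative x lam (w := twist D x lam) : D 1 x -> D 0 lam ->
  dgla_d D w + dgla_br D x w = dgla_br D (curvature x) lam.
Proof.
move=> x1 l0; rewrite /w /twist /curvature linearD dgla_d_sq add0r.
rewrite (dgla_leibniz lam x1) linearDr linearDl linearZl_LR.
have J := dgla_jacobi x1 x1 l0.
(* For odd [x] the Jacobi identity reads [x, [x, lam]] = [[x, x], lam] - [x, [x, lam]]. *)
have -> : dgla_br D (dgla_br D x x) lam = 2%:R *: dgla_br D x (dgla_br D x lam).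
  rewrite scaler_nat mulr2n {1}J mulr1 expr1z scaleN1r.
  by rewrite -addrA addNr addr0.
rewrite scalerA mulVf ?pnatr_eq0// scale1r expr1z scaleN1r.
by rewrite addrA subrK.
Qed.

Lemma dgla_br_sym1 x y : D 1 x -> D 1 y -> dgla_br D y x = dgla_br D x y.
Proof. by move=> x1 y1; rewrite (dgla_anti y1 x1) mulr1 expr1z scaleN1r opprK. Qed.

Lemma gauge_step_MC (R : realType) (rf : realification R k) X Y :
  MC D X -> gauge_step D X Y -> MC D Y.
Proof.
move=> [X1 FX] [lam [gamma [t [l0 hg g0 <-]]]].
have [g1 _] := hg t; split => //; rewrite -/(curvature _).
pose F i (s : k^o) : k^o := v2r (curvature (gamma s)) 0 i.
(* The matrix of the map x |-> [x, lam], constant in time. *)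
pose A i j : k := v2r (dgla_br D (r2v (delta_mx 0 j)) lam) 0 i.
have lin i (c : k) (x y : L) : v2r (c *: x + y) 0 i = c * v2r x 0 i + v2r y 0 i.
  by rewrite linearP !mxE.
have Fd i (s : k^o) : is_derive s 1 (F i) (\sum_j A i j * F j s).
  have [gs1 gd] := hg s.
  have w1 := twist_deg gs1 l0.
  have h1 := @is_derive_lin _ _ _ (fun x => v2r (dgla_d D x) 0 i) _ _ _ _
    (fun c x y => etrans (congr1 (fun z => v2r z 0 i) (linearP _ c x y)) (lin i c _ _)) gd.
  have h2 := @is_derive_bilin _ _ _ (fun x y => v2r (dgla_br D x y) 0 i) _ _ _ _ _ _
    (fun c x y z => etrans (congr1 (fun z => v2r z 0 i) (linearPl _ z c x y)) (lin i c _ _))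
    (fun c x y z => etrans (congr1 (fun z => v2r z 0 i) (linearPr _ z c x y)) (lin i c _ _)) gd gd.
  have -> : F i = (fun x => v2r (dgla_d D (gamma x)) 0 i +
      v2r (dgla_br D (gamma x) (gamma x)) 0 i * 2%:R^-1).
    by apply/funext => x; rewrite /F /curvature linearD linearZ !mxE [_^-1 * _]mulrC.
  apply: (is_derive_eq (is_deriveD h1 (is_derive_mulr_cst _ h2))).
  rewrite v2rK (dgla_br_sym1 gs1 w1) -mulr2n -[X in X / _]mulr_natr mulfK ?pnatr_eq0//.
  have -> (x y : L) : v2r x 0 i + v2r y 0 i = v2r (x + y) 0 i by rewrite linearD mxE.
  rewrite curvature_derivative//.
  rewrite (linear_coordE (l := fun x => v2r (dgla_br D x lam) 0 i)).
    by apply: eq_bigr => j _; rewrite mulrC.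
  by move=> c x y; rewrite linearPl lin.
have F0 i : F i 0 = 0 by rewrite /F g0 /curvature FX linear0 mxE.
apply: (can_inj v2rK); rewrite linear0; apply/rowP => i.
by rewrite [RHS]mxE; exact: (linear_ode rf Fd F0).
Qed.

Lemma gauge_orbit_MC (R : realType) (rf : realification R k) X :
  MC D X -> gauge_orbit D X `<=` MC D.
Proof.
move=> + Y XY; elim: XY => {X Y}[X Y XY hX|//|X Y Z _ IH1 _ IH2 /IH1 //].
exact: gauge_step_MC rf _ _ hX XY.
Qed.

End Orbit.

(** * The bracket in a chart *)

Section Jacobiator.
Context {R : realType} {k : numFieldType} (rf : realification R k) {m : nat}.
Variables (U : set 'rV[k]_m) (pi : 'rV[k]_m -> 'M[k]_m).
Hypotheses (oU : open U) (pi_smooth : smooth U pi)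
  (pi_anti : forall u i j, U u -> pi u j i = - pi u i j).

Local Notation bb := (bivector_bracket pi).

Lemma derive_bivector_bracket (g h : 'rV[k]_m -> k^o) u l :
  smooth U g -> smooth U h -> U u ->
  'D_('e_l) (bb g h) u = \sum_i \sum_j
    ('D_('e_l) (fun x => pi x i j : k^o) u * 'D_('e_i) g u * 'D_('e_j) h u
     + pi u i j * 'D_('e_l) ('D_('e_i) g) u * 'D_('e_j) h u
     + pi u i j * 'D_('e_i) g u * 'D_('e_l) ('D_('e_j) h) u).
Proof.
move=> gs hs Uu.
have aux (p p' q q' r r' : k) :
    p * q * r' + r * (p * q' + q * p') = p' * q * r + p * q' * r + p * q * r'.
  by ring.
have D (f : 'rV[k]_m -> k^o) : Cn 1 U f -> is_derive u 'e_l f ('D_('e_l) f u).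
  by move=> [fd _]; apply/derivableP/diff_derivable/fd.
have D1 (f : 'rV[k]_m -> k^o) i : smooth U f ->
    is_derive u 'e_l ('D_('e_i) f : _ -> k^o) ('D_('e_l) ('D_('e_i) f) u).
  by move=> /(_ 2%N)[_ fC]; apply: D; exact: fC.
have Dp i j : is_derive u 'e_l (fun x => pi x i j : k^o)
    ('D_('e_l) (fun x => pi x i j : k^o) u).
  by apply: D; apply: Cn_coord => //; exact: pi_smooth.
have [_ <-//] : is_derive u 'e_l (bb g h) (\sum_i \sum_j
    ('D_('e_l) (fun x => pi x i j : k^o) u * 'D_('e_i) g u * 'D_('e_j) h u
     + pi u i j * 'D_('e_l) ('D_('e_i) g) u * 'D_('e_j) h u
     + pi u i j * 'D_('e_i) g u * 'D_('e_l) ('D_('e_j) h) u)).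
apply: is_derive_bigsum => i; apply: is_derive_bigsum => j.
have H := is_derive_mul (is_derive_mul (Dp i j) (D1 g i gs)) (D1 h j hs).
exact: (is_derive_eq H (aux _ _ _ _ _ _)).
Qed.

(* The second derivatives of the functions cancel by antisymmetry of [pi]. *)
Lemma jacobiator_gradient u : U u ->
  exists J : ('I_m -> k) -> ('I_m -> k) -> ('I_m -> k) -> k,
  forall f g h, smooth U f -> smooth U g -> smooth U h ->
  bb f (bb g h) u + bb g (bb h f) u + bb h (bb f g) u =
  J (fun i => 'D_('e_i) f u) (fun i => 'D_('e_i) g u) (fun i => 'D_('e_i) h u).
Proof.
move=> Uu.
(* The terms of {a, {b, c}} in which the outer derivative falls on [pi]; they involve only
   gradients. *)
pose S (a b c : 'I_m -> k) := \sum_l (\sum_i pi u i l * a i) *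
  (\sum_i \sum_j 'D_('e_l) (fun x => pi x i j : k^o) u * b i * c j).
exists (fun a b c => S a b c + S b c a + S c a b) => f g h fs gs hs.
(* [X a] is the Hamiltonian vector field {a, -} at [u]; obtaining it through an existential keeps it
   opaque. *)
have [X XE] : exists X : ('rV[k]_m -> k^o) -> 'I_m -> k,
  forall a l, X a l = \sum_i pi u i l * 'D_('e_i) a u by eexists.
(* The Hessian of [a] evaluated on [X b] and [X c], symmetric in these by [derive_comm]. *)
pose q (a b c : 'rV[k]_m -> k^o) :=
  \sum_l \sum_j 'D_('e_l) ('D_('e_j) a) u * X b l * X c j.
have q_sym a b c : smooth U a -> q a b c = q a c b.
  move=> aS; rewrite /q exchange_big/=; apply: eq_bigr => l _.
  apply: eq_bigr => j _; rewrite (derive_comm rf _ _ oU Uu (aS 2%N)); ring.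
have bbE a b c : smooth U b -> smooth U c ->
    bb a (bb b c) u = S (fun i => 'D_('e_i) a u) (fun i => 'D_('e_i) b u)
      (fun i => 'D_('e_i) c u) - q b a c + q c a b.
  move=> bS cS; rewrite /bivector_bracket -/(bivector_bracket pi b c).
  rewrite exchange_big /S /q -sumrN -!big_split/=; apply: eq_bigr => l _.
  rewrite -mulr_suml (derive_bivector_bracket l bS cS Uu) -(XE a).
  have -> : \sum_j 'D_('e_l) ('D_('e_j) b) u * X a l * X c j =
     - (X a l * \sum_i \sum_j pi u i j * 'D_('e_l) ('D_('e_i) b) u * 'D_('e_j) c u).
    rewrite mulr_sumr -sumrN; apply: eq_bigr => i _.
    rewrite (XE c) !mulr_sumr -sumrN; apply: eq_bigr => j _.
    by rewrite (pi_anti i j Uu); ring.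
  have -> : \sum_j 'D_('e_l) ('D_('e_j) c) u * X a l * X b j =
     X a l * \sum_i \sum_j pi u i j * 'D_('e_i) b u * 'D_('e_l) ('D_('e_j) c) u.
    rewrite exchange_big mulr_sumr; apply: eq_bigr => i _.
    rewrite (XE b) !mulr_sumr; apply: eq_bigr => j _; ring.
  rewrite opprK -!mulrDr -!big_split/=; congr (_ * _).
  by apply: eq_bigr => i _; rewrite -!big_split.
(* Each Hessian occurs twice in the cyclic sum, with opposite signs and its arguments exchanged. *)
rewrite !bbE// (q_sym g f h)// (q_sym h f g)// (q_sym f g h)//; ring.
Qed.

End Jacobiator.

(** * The bivector induced by Pi in a chart of an orbit *)

Section Chart.
Context {R : realType} {k : numFieldType} (rf : realification R k).
Context {L : vectType k} {B : lmodType k} (M : mcp L B).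
Variables (O : set L) (m : nat) (U : set 'rV[k]_m) (phi : 'rV[k]_m -> L).
Hypotheses (O_MC : O `<=` MC M) (phi_chart : orbit_chart M O U phi).

Local Notation pair := (mcp_pair M).
Local Notation T u i := (dmap phi u ('e_i)).

Let oU : open U := chart_open phi_chart.

Let hU u : U u -> MC M (phi u).
Proof. by move=> Uu; apply: O_MC; exact: (chart_sub phi_chart). Qed.

Let phi1 u : U u -> M 1 (phi u).
Proof. by move=> /hU[]. Qed.

Let pairl (a : B) (c : k) x y : pair (c *: x + y) a = c * pair x a + pair y a.
Proof. by rewrite linearPl. Qed.

Lemma is_derive_chart u h : U u -> is_derive u h (v2r \o phi) (v2r (dmap phi u h)).
Proof.
move=> Uu; rewrite /dmap r2vK; apply/derivableP/diff_derivable.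
by have [fd _] := chart_smooth phi_chart 1; apply: fd.
Qed.

Lemma dmap_sum u h : U u -> dmap phi u h = \sum_i h 0 i *: T u i.
Proof.
move=> Uu; have [fd _] := chart_smooth phi_chart 1; have du := fd u Uu.
rewrite /dmap deriveE// {1}(row_sum_delta h) linear_sum linear_sum/=.
by apply: eq_bigr => i _; rewrite linearZ linearZ/= deriveE.
Qed.

Lemma dmap_tangent u h : U u ->
  exists2 x, M 0 x & dmap phi u h = twist M (phi u) x.
Proof.
move=> Uu; have : range (dmap phi u) (dmap phi u h) by exists h.
by rewrite (chart_tangent phi_chart Uu).
Qed.

Lemma dmap_deg u h : U u -> M 1 (dmap phi u h).
Proof.
by move=> Uu; have [x x0 ->] := dmap_tangent h Uu; exact: (twist_deg (phi1 Uu) x0).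
Qed.

(** A relation between the [T u i] as functionals on B^2 is, by non-degeneracy, a vector killed by
    the differential of [phi], hence zero as [phi] is an immersion. *)
Lemma dual_frame u : U u -> exists2 a : 'I_m -> B, (forall i, mcp_alg M 2 (a i)) &
  forall i j, pair (T u i) (a j) = (i == j)%:R.
Proof.
move=> Uu.
apply: (@dual_family _ B (mcp_alg M 2) m (fun i => pair (T u i))).
- exact: gr0.
- exact: gr_linear.
- by move=> i c a b; rewrite linearPr.
- move=> c hc; apply: (chart_immersion phi_chart Uu).
  apply: (@mcp_nondegl _ _ _ M 1); first exact: dmap_deg.
  move=> b b2; rewrite (dmap_sum _ Uu) linear_sumlz -[RHS](hc b b2).
  by apply: eq_bigr => i _; rewrite linearZl_LR.
Qed.

Lemma smooth_lin (W : normedModType k) (l : L -> k^o) (f : W -> L) n (S : set W) :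
  open S -> (forall (c : k) x y, l (c *: x + y) = c * l x + l y) ->
  Cn n S (v2r \o f) -> Cn n S (fun x => l (f x)).
Proof.
move=> oS ll fC; rewrite (_ : (fun x => _) =
    fun x => \sum_s (v2r (f x) 0 s * l (r2v (delta_mx 0 s))) : k^o); last first.
  by apply/funext => x; exact: linear_coordE.
apply: Cn_sum => // s; apply: CnM => //; last exact: Cn_cst.
exact: (Cn_coord oS 0 s fC).
Qed.

Lemma smooth_pair a : smooth U (fun u => pair (phi u) a : k^o).
Proof. by move=> n; exact: (smooth_lin oU (pairl a) (chart_smooth phi_chart n)). Qed.

Lemma smooth_pair_dmap i a : smooth U (fun u => pair (T u i) a : k^o).
Proof.
move=> n; apply: (smooth_lin (f := fun u => T u i) oU (pairl a)).
rewrite (_ : _ \o _ = 'D_('e_i) (v2r \o phi)).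
  by have [_ h] := chart_smooth phi_chart n.+1; exact: h.
by apply/funext => u /=; rewrite /dmap r2vK.
Qed.

Lemma derive_pair u a h : U u ->
  is_derive u h (fun u => pair (phi u) a : k^o) (pair (dmap phi u h) a).
Proof.
move=> Uu; have := is_derive_lin (pairl a) (is_derive_chart h Uu).
by rewrite v2rK.
Qed.

Lemma smooth_Pi a b : mcp_alg M 2 a -> mcp_alg M 2 b ->
  smooth U (fun u => mcp_Pi M (phi u) a b : k^o).
Proof.
move=> a2 b2 n; have [N [e [c cE]]] := Pi_polynomial M.
have tw s x : Cn n U (fun u => pair (twist M (phi u) (e s)) x : k^o).
  rewrite (_ : (fun u => _) = fun u => pair (dgla_d M (e s)) x +
    pair (dgla_br M (phi u) (e s)) x : k^o); last first.
    by apply/funext => u; rewrite /twist linearDl.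
  apply: CnD => //; first exact: Cn_cst.
  have ll : forall (z : k) y y', pair (dgla_br M (z *: y + y') (e s)) x =
      z * pair (dgla_br M y (e s)) x + pair (dgla_br M y' (e s)) x.
    by move=> z y y'; rewrite linearPl pairl.
  exact: (smooth_lin oU (l := fun y => pair (dgla_br M y (e s)) x) ll
    (chart_smooth phi_chart n)).
have H : Cn n U (fun u => \sum_s \sum_t pair (twist M (phi u) (e s)) a
    * pair (twist M (phi u) (e t)) b * pair (phi u) (c s t) : k^o).
  apply: Cn_sum => // s; apply: Cn_sum => // t.
  by apply: CnM => //; [exact: CnM|exact: smooth_pair].
apply: (Cn_eq oU _ H) => u Uu.
by have [-> _] := cE _ _ _ (hU Uu) a2 b2.
Qed.

(** Since [phi] maps [U] into MC, Pi agrees near [u] with the polynomial of [Pi_polynomial], whose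
    derivative is [dPi]. *)
Lemma derive_Pi u a b h : U u -> mcp_alg M 2 a -> mcp_alg M 2 b ->
  'D_h (fun u => mcp_Pi M (phi u) a b : k^o) u = dPi M (phi u) (dmap phi u h) a b.
Proof.
move=> Uu a2 b2; have [N [e [c cE]]] := Pi_polynomial M.
have [_ ->] := cE _ _ _ (hU Uu) a2 b2.
have tw s x : is_derive u h (fun u => pair (twist M (phi u) (e s)) x : k^o)
    (pair (dgla_br M (dmap phi u h) (e s)) x).
  rewrite (_ : (fun u => _) = cst (pair (dgla_d M (e s)) x : k^o) +
    (fun u => pair (dgla_br M (phi u) (e s)) x : k^o)); last first.
    by apply/funext => v; rewrite /twist linearDl.
  have ll : forall (z : k) y y', pair (dgla_br M (z *: y + y') (e s)) x =
      z * pair (dgla_br M y (e s)) x + pair (dgla_br M y' (e s)) x.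
    by move=> z y y'; rewrite linearPl pairl.
  have := is_derive_lin (l := fun y => pair (dgla_br M y (e s)) x) ll
    (is_derive_chart h Uu).
  rewrite v2rK => H.
  by apply: (is_derive_eq (is_deriveD (is_derive_cst _ _ _) H)); rewrite add0r.
pose F u : k^o := \sum_s \sum_t pair (twist M (phi u) (e s)) a
    * pair (twist M (phi u) (e t)) b * pair (phi u) (c s t).
rewrite (@near_eq_derive _ _ _ _ F); last first.
  have := open_nbhs_nbhs (conj oU Uu); apply: filterS => v Uv.
  by have [-> _] := cE _ _ _ (hU Uv) a2 b2.
have aux (p p' q q' r r' : k) :
    p * q * r' + r * (p * q' + q * p') = p' * q * r + p * q' * r + p * q * r'.
  by ring.
have [_ <-//] : is_derive u h F (\sum_s \sum_t
     (pair (dgla_br M (dmap phi u h) (e s)) a * pair (twist M (phi u) (e t)) b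
        * pair (phi u) (c s t)
    + pair (twist M (phi u) (e s)) a * pair (dgla_br M (dmap phi u h) (e t)) b
        * pair (phi u) (c s t)
    + pair (twist M (phi u) (e s)) a * pair (twist M (phi u) (e t)) b
        * pair (dmap phi u h) (c s t))).
apply: is_derive_bigsum => s; apply: is_derive_bigsum => t.
exact: (is_derive_eq (is_derive_mul (is_derive_mul (tw s a) (tw t b))
  (derive_pair (c s t) h Uu)) (aux _ _ _ _ _ _)).
Qed.

(** A covector differs from its expansion in the dual frame by one that annihilates the tangent
    space, and [delta] kills the difference. *)
Lemma Pi_frame u (e : 'I_m -> B) a b : U u ->
  (forall i, mcp_alg M 2 (e i)) -> (forall i j, pair (T u i) (e j) = (i == j)%:R) ->
  mcp_alg M 2 a -> mcp_alg M 2 b ->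
  mcp_Pi M (phi u) a b = \sum_i \sum_j
    mcp_Pi M (phi u) (e i) (e j) * pair (T u i) a * pair (T u j) b.
Proof.
move=> Uu e2 eE a2 b2; have hX := hU Uu.
have d0 : mcp_delta M (phi u) 0 = 0.
  by have := deltaN hX 0; rewrite oppr0 => /eqP; rewrite -subr_eq0 opprK -mulr2n
    -scaler_nat scaler_eq0 pnatr_eq0 => /eqP.
have exp x : mcp_alg M 2 x -> mcp_delta M (phi u) x =
    \sum_i pair (T u i) x *: mcp_delta M (phi u) (e i).
  move=> x2; pose y := \sum_i pair (T u i) x *: e i.
  have y2 : mcp_alg M 2 y.
    rewrite /y; elim/big_ind: _ => [|v w v2 w2|i _]; first exact: gr0.
      by rewrite -[v]scale1r; apply: gr_linear.
    by rewrite -[_ *: _]addr0; apply: gr_linear => //; apply: gr0.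
  have yE : mcp_delta M (phi u) y = \sum_i pair (T u i) x *: mcp_delta M (phi u) (e i).
    rewrite /y; elim/big_rec2: _ => // i v w _ <-.
    by rewrite (deltaP hX).
  rewrite -yE; apply: subr0_eq; rewrite -(deltaN hX) -[_ x]scale1r -(deltaP hX) scale1r.
  apply: (delta_annihilator hX).
    by rewrite addrC -scaleN1r; apply: gr_linear.
  move=> l l0.
  have : range (dmap phi u) (twist M (phi u) l).
    by rewrite (chart_tangent phi_chart Uu); exists l.
  move=> [h _ <-]; rewrite (dmap_sum h Uu) linear_sumlz big1// => i _.
  rewrite linearZl_LR linearBr /y linear_sumr (bigD1 i)//= big1 ?addr0.
    rewrite linearZr_LR eE eqxx; set p := pair (T u i) x.
    by rewrite [p *: _]mulr1 subrr scaler0.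
  by move=> j ji; rewrite linearZr_LR eE eq_sym (negbTE ji) scaler0.
rewrite /mcp_Pi (exp a)// linear_sumlz linear_sumr; apply: eq_bigr => i _.
rewrite (exp b)// linear_sumr linear_sumr; apply: eq_bigr => j _.
by rewrite linearZl_LR linearZr_LR !linearZr_LR !scaleoE; ring.
Qed.

Section Induced.
Variable a : 'rV[k]_m -> 'I_m -> B.
Hypotheses (a2 : forall u i, mcp_alg M 2 (a u i))
  (aE : forall u, U u -> forall i j, pair (T u i) (a u j) = (i == j)%:R).

Definition induced_bivector u : 'M[k]_m :=
  \matrix_(i, j) mcp_Pi M (phi u) (a u i) (a u j).

Lemma induced_bivectorE u b c : U u -> mcp_alg M 2 b -> mcp_alg M 2 c ->
  mcp_Pi M (phi u) b c = \sum_i \sum_j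
    induced_bivector u i j * pair (T u i) b * pair (T u j) c.
Proof.
move=> Uu b2 c2; rewrite (Pi_frame Uu (a2 u) (aE Uu) b2 c2).
by apply: eq_bigr => i _; apply: eq_bigr => j _; rewrite mxE.
Qed.

Lemma induced_bivector_anti u i j : U u ->
  induced_bivector u j i = - induced_bivector u i j.
Proof. by move=> Uu; rewrite !mxE (Pi_anti (hU Uu)). Qed.

(* The frame [a u] need not depend continuously on [u]; near [u0] the bivector
   is expressed through the frame at [u0]. *)
Lemma induced_bivector_smooth : smooth U induced_bivector.
Proof.
move=> n; apply: Cn_local => u0 Uu0.
(* [P u] compares the tangent frame at [u] with the dual frame at [u0]. It is the identity at [u0],
   hence invertible on the open neighbourhood [S], where the bivector is recovered from Q = P^T pi
   P. *)
pose P u : 'M[k]_m := \matrix_(i, j) pair (T u i) (a u0 j).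
pose Q u : 'M[k]_m := \matrix_(i, j) mcp_Pi M (phi u) (a u0 i) (a u0 j).
pose S : set 'rV[k]_m := [set u | U u /\ \det (P u) != 0].
have Pe p i j : Cn p U (fun u => P u i j : k^o).
  rewrite (_ : (fun u => _) = fun u => pair (T u i) (a u0 j) : k^o).
    exact: smooth_pair_dmap.
  by apply/funext => u; rewrite mxE.
have oS : open S.
  rewrite openE => u [Uu du]; apply: filterI; first exact: open_nbhs_nbhs.
  have /(_ u Uu) := Cn_det oU (Pe 0%N); move=> cd; exact: (cvgr_neq0 _ cd du).
have S0 : S u0.
  split=> //; rewrite (_ : P u0 = 1%:M) ?det1 ?oner_eq0//.
  by apply/matrixP => i j; rewrite !mxE aE.
have SU : S `<=` U by move=> u [].
have Pu u : S u -> P u \in unitmx by move=> [_]; rewrite unitmxE unitfE.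
exists S => //.
have Ie := Cn_invmx oS Pu (fun i j => Cn_sub SU (Pe n i j)).
have Qe i j : Cn n S (fun u => Q u i j : k^o).
  rewrite (_ : (fun u => _) = fun u => mcp_Pi M (phi u) (a u0 i) (a u0 j) : k^o).
    by apply: Cn_sub SU _; exact: smooth_Pi.
  by apply/funext => u; rewrite mxE.
apply: Cn_mx => // i j.
have H : Cn n S (fun u => \sum_q (\sum_p invmx (P u) p i * Q u p q) * invmx (P u) q j : k^o).
  by apply: Cn_sum => // q; apply: CnM => //; apply: Cn_sum => // p; apply: CnM.
apply: (Cn_eq oS _ H) => u Su; have Uu := SU _ Su.
have QE : Q u = (P u)^T *m induced_bivector u *m P u.
  apply/matrixP => p q; rewrite !mxE (induced_bivectorE Uu (a2 _ _) (a2 _ _)).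
  rewrite exchange_big/=; apply: eq_bigr => t _.
  rewrite !mxE mulr_suml; apply: eq_bigr => s _.
  by rewrite !mxE [pair _ _ * mcp_Pi _ _ _ _]mulrC.
have -> : induced_bivector u = (invmx (P u))^T *m Q u *m invmx (P u).
  rewrite QE !mulmxA -trmx_mul mulmxV ?Pu// trmx1 mul1mx -mulmxA mulmxV ?Pu//.
  by rewrite mulmx1.
rewrite !mxE; apply: eq_bigr => q _; rewrite !mxE; congr (_ * _).
by apply: eq_bigr => p _; rewrite !mxE.
Qed.

Local Notation bb := (bivector_bracket induced_bivector).
Local Notation x_ b := (fun u => pair (phi u) b : k^o).

Lemma bracket_linear u b c : U u -> mcp_alg M 2 b -> mcp_alg M 2 c ->
  bb (x_ b) (x_ c) u = mcp_Pi M (phi u) b c.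
Proof.
move=> Uu b2 c2; rewrite (induced_bivectorE Uu b2 c2).
apply: eq_bigr => i _; apply: eq_bigr => j _.
have [_ ->] := derive_pair b 'e_i Uu; have [_ ->] := derive_pair c 'e_j Uu.
by [].
Qed.

(** The inner bracket is Pi (c, d), and the outer one differentiates it along the Hamiltonian vector
    of [b]. *)
Lemma bracket_bracket_linear u b c d : U u ->
  mcp_alg M 2 b -> mcp_alg M 2 c -> mcp_alg M 2 d ->
  bb (x_ b) (bb (x_ c) (x_ d)) u =
  dPi M (phi u)
    (twist M (phi u) (rho_of M (mcp_alg M) pair (phi u) (mcp_delta M (phi u) b))) c d.
Proof.
move=> Uu b2 c2 d2; have hX := hU Uu.
set V := twist _ _ _.
have b1 := delta_deg hX b2.
(* Both sides lie in L^1 and pair equally with every covector in B^2. *)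
have VE : V = \sum_j (\sum_i induced_bivector u i j * pair (T u i) b) *: T u j.
  apply: subr0_eq; apply: (@mcp_nondegl _ _ _ M 1).
    rewrite [V - _]addrC -scaleN1r; apply: gr_linear.
      elim/big_ind: _ => [|v w v1 w1|j _]; first exact: gr0.
        by rewrite -[v]scale1r; apply: gr_linear.
      by rewrite -[_ *: _]addr0; apply: gr_linear; [exact: dmap_deg|exact: gr0].
    exact: (twist_deg (phi1 Uu) (rho_deg hX b1)).
  move=> c' c'2; rewrite linearBl -(Pi_hamiltonian hX b2 c'2).
  rewrite (induced_bivectorE Uu b2 c'2) linear_sumlz exchange_big/=.
  apply/eqP; rewrite subr_eq0; apply/eqP; apply: eq_bigr => j _.
  by rewrite linearZl_LR scaleoE mulr_suml.
have dPl : forall (z : k) y y', dPi M (phi u) (z *: y + y') c d =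
    z * dPi M (phi u) y c d + dPi M (phi u) y' c d.
  move=> z y y'; rewrite /dPi !linearPl !scaleoE; ring.
have dP0 : dPi M (phi u) 0 c d = 0 by rewrite /dPi !linear0l oppr0 !addr0.
have dPs (I : finType) (z : I -> k) y : dPi M (phi u) (\sum_i z i *: y i) c d =
    \sum_i z i * dPi M (phi u) (y i) c d.
  by elim/big_rec2: _ => // i v w _ <-; rewrite dPl.
rewrite VE dPs [LHS]exchange_big/=; apply: eq_bigr => j _.
rewrite mulr_suml; apply: eq_bigr => i _.
have [_ ->] := derive_pair b 'e_i Uu.
congr (_ * _); rewrite -(derive_Pi _ Uu c2 d2); apply: near_eq_derive.
have := open_nbhs_nbhs (conj oU Uu); apply: filterS => v Uv.
exact: bracket_linear.
Qed.

(** The Jacobiator at [u] sees only gradients, so f, g, h may be replaced by functions (phi, b), for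
    which [dPi_cyclic] applies. *)
Lemma induced_bivector_jacobi (f g h : 'rV[k]_m -> k^o) u :
  smooth U f -> smooth U g -> smooth U h -> U u ->
  bb f (bb g h) u + bb g (bb h f) u + bb h (bb f g) u = 0.
Proof.
move=> fs gs hs Uu; have hX := hU Uu.
(* The covector whose pairing with [phi] has the same gradient at [u] as the given function. *)
pose cov (f : 'rV[k]_m -> k^o) : B := \sum_i 'D_('e_i) f u *: a u i.
have cov2 f' : mcp_alg M 2 (cov f').
  rewrite /cov; elim/big_ind: _ => [|v w v2 w2|i _]; first exact: gr0.
    by rewrite -[v]scale1r; apply: gr_linear.
  by rewrite -[_ *: _]addr0; apply: gr_linear => //; apply: gr0.
have covE f' i : 'D_('e_i) (x_ (cov f')) u = 'D_('e_i) f' u.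
  have [_ ->] := derive_pair (cov f') 'e_i Uu.
  rewrite /cov linear_sumr (bigD1 i)//= big1 ?addr0.
    by rewrite linearZr_LR aE// eqxx scaleoE mulr1.
  by move=> j ji; rewrite linearZr_LR aE// eq_sym (negbTE ji) scaler0.
have [J JE] := jacobiator_gradient rf oU induced_bivector_smooth
  (fun u i j => @induced_bivector_anti u i j) Uu.
have gradE f' : (fun i => 'D_('e_i) (x_ (cov f')) u) = (fun i => 'D_('e_i) f' u).
  by apply/funext => i; exact: covE.
have JL := JE _ _ _ (smooth_pair (cov f)) (smooth_pair (cov g)) (smooth_pair (cov h)).
apply: (etrans (JE _ _ _ fs gs hs)).
apply: (etrans (esym (f_equal3 J (gradE f) (gradE g) (gradE h)))).
apply: (etrans (esym JL)).
rewrite (bracket_bracket_linear Uu (cov2 f) (cov2 g) (cov2 h)).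
rewrite (bracket_bracket_linear Uu (cov2 g) (cov2 h) (cov2 f)).
rewrite (bracket_bracket_linear Uu (cov2 h) (cov2 f) (cov2 g)).
by rewrite addrC addrA; exact: dPi_cyclic.
Qed.

End Induced.

End Chart.

(** * The Poisson structure on a gauge orbit *)

Lemma realification_exists (R : realType) (k : numFieldType) :
  k = (R : numFieldType) \/ k = (R[i] : numFieldType) ->
  inhabited (realification R k).
Proof.
by move=> [->|->]; split; [exact: realification_real|exact: realification_complex].
Qed.

Theorem proposition6p1 (R : realType) (k : numFieldType)
    (hk : k = (R : numFieldType) \/ k = (R[i] : numFieldType))
    (L : vectType k) (B : lmodType k) (M : mcp L B)
    (X0 : L) (hX0 : MC M X0) :
  poisson_on_orbit M (gauge_orbit M X0).
Proof.
have [rf] := realification_exists hk.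
have orbit_MC := gauge_orbit_MC rf hX0.
split.
- by move=> X a b /orbit_MC hX a2 b2; exact: Pi_anti.
- move=> X a b /orbit_MC hX a2 b2 aT.
  rewrite /mcp_Pi (delta_annihilator hX a2) ?linear0l ?linear0r// => x x0.
  by apply: aT; exists x.
move=> m U phi chart.
(* A dual frame is chosen at each point of [U] separately, with the zero family as default value
   outside [U]. *)
have /choice[a aP] : forall u, exists a : 'I_m -> B,
    (forall i, mcp_alg M 2 (a i)) /\ (U u -> forall i j,
      mcp_pair M (dmap phi u 'e_i) (a j) = (i == j)%:R).
  move=> u; have [Uu|nUu] := pselect (U u).
    by have [a a2 aE] := dual_frame orbit_MC chart Uu; exists a.
  by exists (fun=> 0); split=> // i; exact: gr0.
have a2 u i : mcp_alg M 2 (a u i) by have [h _] := aP u; exact: h.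
have aE u : U u -> forall i j, mcp_pair M (dmap phi u 'e_i) (a u j) = (i == j)%:R.
  by have [_ h] := aP u; exact: h.
exists (induced_bivector M phi a); split; first split.
- exact: (induced_bivector_smooth orbit_MC chart a2 aE).
- by move=> u i j Uu; exact: (induced_bivector_anti orbit_MC chart a2 i j Uu).
- move=> f g h fs gs hs u Uu.
  exact: (induced_bivector_jacobi rf orbit_MC chart a2 aE fs gs hs Uu).
move=> u b c Uu b2 c2.
exact: (induced_bivectorE orbit_MC chart a2 aE Uu b2 c2).
Qed.
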